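(* Let $H$ be an arbitrary Hadamard matrix of size $4$. Then the quantum group corresponding to the category $F_H(\mathsf{NCBipartEven}_4)$ is isomorphic to $SO_4^{-1}$.
   Context: Hadamard matrix of size $N$: an $N\times N$ matrix $H$ with entries $\pm1$ and $HH^{T}=N\cdot I=H^{T}H$. Diagrammatic categories: all categories are strict rigid monoidal $\mathbb{C}$-linear $\dagger$-categories with object set $\mathbb{N}_0$, tensor product of objects being addition. For $N\in\mathbb{C}\setminus\{0\}$, $\mathsf{NCBipart}_N$ is the category presented by generators $b_{k,l},w_{k,l}\colon k\to l$ ($k,l\in\mathbb{N}_0$), with $b_{k,l}^\dagger=b_{l,k}$, $w_{k,l}^\dagger=w_{l,k}$, and relations (together with those obtained by applying $\dagger$): (1) $b_{1,1}=w_{1,1}=\mathrm{id}_1$, $b_{0,0}=w_{0,0}=N$; (2) for $s=b$ and $s=w$ and $m\ge1$: $(s_{k_1+m,l_1}\otimes\mathrm{id}_{l_2})(\mathrm{id}_{k_1}\otimes s_{k_2,m+l_2})=s_{k_1+k_2,l_1+l_2}$; (3) $b_{0,2}=w_{0,2}$; (4) $b_{2,1}w_{1,2}=N^{-1}b_{0,1}w_{1,0}$. $\mathsf{NCBipartEven}_N$ is the smallest subcategory on all objects, closed under composition, tensor product, linear combinations and $\dagger$, containing all identities, $b_{2,2}$, $w_{2,2}$ and $b_{2,0}$. For a Hadamard matrix $H$ of size $N$, $F_H$ is the monoidal $\dagger$-functor with $F_H(k)=(\mathbb{C}^N)^{\otimes k}$, $F_H(b_{k,l})=T_{k,l}$,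 $F_H(w_{k,l})=N^{-(k+l)/2}(H^{T})^{\otimes l}T_{k,l}H^{\otimes k}$, where the entries of $T_{k,l}\colon(\mathbb{C}^N)^{\otimes k}\to(\mathbb{C}^N)^{\otimes l}$ are $1$ if all $k+l$ indices coincide and $0$ otherwise (and $T_{0,0}=N$). The (orthogonal compact matrix) quantum group corresponding to a concrete rigid monoidal $\dagger$-category $\mathfrak{C}$, $\mathfrak{C}(k,l)\subseteq\mathscr{L}((\mathbb{C}^N)^{\otimes k},(\mathbb{C}^N)^{\otimes l})$, is the one whose $*$-algebra is the universal $*$-algebra $\mathscr{O}(G)$ generated by $u^i_j$, $i,j=1,\dots,N$, with relations $uu^\dagger=1=u^\dagger u$ and $Tu^{\otimes k}=u^{\otimes l}T$ for all $T\in\mathfrak{C}(k,l)$, with comultiplication $\Delta(u^i_j)=\sum_ku^i_k\otimes u^k_j$. Isomorphism of quantum groups means $*$-isomorphism of these algebras compatible with $\Delta$. $SO_4^{-1}$ is the anticommutative deformation of $SO_4$: $\mathscr{O}(SO_4^{-1})$ is the universal $*$-algebra generated by $u^i_j$, $i,j=1,\dots,4$, with $u^i_j=(u^i_j)^*$, $uu^{T}=1=u^{T}u$, $u^i_ku^i_l=-u^i_lu^i_k$ and $u^k_iu^l_i=-u^l_iu^k_i$ for $k\ne l$, $u^i_ku^j_l=u^j_lu^i_k$ for $i\neq j$, $k\ne l$, and $\sum_{\sigma\in S_4}u^1_{\sigma(1)}u^2_{\sigma(2)}u^3_{\sigma(3)}u^4_{\sigma(4)}=1$, with $\Delta(u^i_j)=\sum_ku^i_k\otimes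 u^k_j$. *)

(* Defs.v *)
From HB Require Import structures.
From mathcomp Require Import all_boot all_order all_algebra perm.
From mathcomp Require Import boolp ring.

Set Implicit Arguments.
Unset Strict Implicit.
Unset Printing Implicit Defensive.

Import Order.TTheory GRing.Theory Num.Theory.

Local Open Scope ring_scope.
Local Open Scope quotient_scope.

(* Unital *-algebras over C, the C-algebra structure being given by the ring
   morphism salg from C to the centre of A (a.x is salg a * x).  The library's
   algType is not used because it excludes the zero ring, which an algebra
   given by generators and relations may a priori be. *)
HB.mixin Record isStarAlgebra (C : numClosedFieldType) A of GRing.PzRing A := {
  salg : {rmorphism C -> A};
  salgC : forall (a : C) (x : A), salg a * x = x * salg a;
  star : A -> A;
  starK : involutive star;
  starD : {morph star : x y / x + y};
  starM : forall x y : A, star (x * y) = star y * star x;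
  star_salg : forall a : C, star (salg a) = salg a^*
}.

#[short(type="starAlgType")]
HB.structure Definition StarAlgebra (C : numClosedFieldType) :=
  {A of GRing.PzRing A & isStarAlgebra C A}.

Section StarAlgebraTheory.
Variable C : numClosedFieldType.

Lemma star0 (A : starAlgType C) : star 0 = 0 :> A.
Proof. by apply: (addIr (star 0)); rewrite -starD !add0r. Qed.

Lemma star1 (A : starAlgType C) : star 1 = 1 :> A.
Proof. by rewrite -[1](rmorph1 (salg : {rmorphism C -> A})) star_salg conjC1. Qed.

Lemma star_sum (A : starAlgType C) I (r : seq I) (P : pred I) (F : I -> A) :
  star (\sum_(i <- r | P i) F i) = \sum_(i <- r | P i) star (F i).
Proof. exact: (big_morph _ (@starD C A) (star0 A)). Qed.

Record star_hom (A B : starAlgType C) (f : A -> B) : Prop := StarHom {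
  star_homD : {morph f : x y / x + y};
  star_homM : {morph f : x y / x * y};
  star_hom_salg : forall a : C, f (salg a) = salg a;
  star_hom_star : forall x, f (star x) = star (f x)
}.

Section StarHomTheory.
Variables (A B : starAlgType C) (f : A -> B).
Hypothesis hf : star_hom f.

Lemma star_hom0 : f 0 = 0.
Proof. by rewrite -(rmorph0 salg) (star_hom_salg hf) rmorph0. Qed.

Lemma star_hom1 : f 1 = 1.
Proof. by rewrite -(rmorph1 salg) (star_hom_salg hf) rmorph1. Qed.

Lemma star_homN x : f (- x) = - f x.
Proof. by apply/eqP; rewrite -addr_eq0 -(star_homD hf) addNr star_hom0. Qed.

Lemma star_hom_sum I (r : seq I) (P : pred I) (F : I -> A) :
  f (\sum_(i <- r | P i) F i) = \sum_(i <- r | P i) f (F i).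
Proof. exact: (big_morph _ (star_homD hf) star_hom0). Qed.

Lemma star_hom_prod I (r : seq I) (P : pred I) (F : I -> A) :
  f (\prod_(i <- r | P i) F i) = \prod_(i <- r | P i) f (F i).
Proof. exact: (big_morph _ (star_homM hf) star_hom1). Qed.

End StarHomTheory.
End StarAlgebraTheory.

Section Universal.
Variables (C : numClosedFieldType) (N : nat).

Inductive term : Type :=
| Tgen of 'I_N & 'I_N
| Tscalar of C
| Tadd of term & term
| Tmul of term & term
| Tstar of term.

Fixpoint eval (A : starAlgType C) (u : 'M[A]_N) (t : term) : A :=
  match t with
  | Tgen i j => u i j
  | Tscalar a => salg a
  | Tadd s t => eval u s + eval u t
  | Tmul s t => eval u s * eval u t
  | Tstar t => star (eval u t)
  end.

HB.instance Definition _ := gen_eqMixin term.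
HB.instance Definition _ := gen_choiceMixin term.

(* A system of relations between N^2 elements u i j, formulated in an
   arbitrary *-algebra. *)
Definition relations := forall A : starAlgType C, 'M[A]_N -> Prop.

Variable P : relations.

(* The universal *-algebra generated by N^2 elements subject to P: two
   *-polynomials are identified when they agree on all elements of all
   *-algebras that satisfy P.  See univ_lift_hom and univ_lift_uniq for the
   universal property; cat_rel_gen and SOm1_rel_gen below check that the
   generators do satisfy the relations. *)
Definition term_eq (s t : term) : bool :=
  `[< forall (A : starAlgType C) (u : 'M[A]_N), P u -> eval u s = eval u t >].

Lemma term_eq_refl : reflexive term_eq.
Proof. by move=> s; apply/asboolP. Qed.

Lemma term_eq_sym : symmetric term_eq.
Proof. by move=> s t; apply/asboolP/asboolP => h A u Pu; rewrite (h _ _ Pu). Qed.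

Lemma term_eq_trans : transitive term_eq.
Proof.
move=> t s r /asboolP h /asboolP k; apply/asboolP => A u Pu.
by rewrite (h _ _ Pu) (k _ _ Pu).
Qed.

Canonical term_equiv :=
  EquivRel term_eq term_eq_refl term_eq_sym term_eq_trans.

Definition univ : Type := {eq_quot term_eq}.
HB.instance Definition _ := Choice.on univ.

Definition cls (t : term) : univ := \pi_({eq_quot term_eq}) t.
Definition rep (x : univ) : term := repr (x : {eq_quot term_eq}).

Definition univ_lift (A : starAlgType C) (u : 'M[A]_N) (x : univ) : A :=
  eval u (rep x).

Lemma univ_lift_cls (A : starAlgType C) (u : 'M[A]_N) t :
  P u -> univ_lift u (cls t) = eval u t.
Proof.
move=> Pu; rewrite /univ_lift /rep /cls.
have /eqmodP/asboolP/(_ A u Pu) -> // :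
  (repr (\pi_({eq_quot term_eq}) t) = t %[mod {eq_quot term_eq}]).
by rewrite reprK.
Qed.

Lemma repK x : cls (rep x) = x.
Proof. exact: reprK. Qed.

Lemma cls_ext s t :
  (forall (A : starAlgType C) (u : 'M[A]_N), P u -> eval u s = eval u t) ->
  cls s = cls t.
Proof. by move=> h; apply/eqmodP/asboolP. Qed.

Lemma univ_ext (x y : univ) :
  (forall (A : starAlgType C) (u : 'M[A]_N), P u ->
     univ_lift u x = univ_lift u y) -> x = y.
Proof. by move=> h; rewrite -(repK x) -(repK y); apply: cls_ext. Qed.

Lemma eval_rep_cls (A : starAlgType C) (u : 'M[A]_N) t :
  P u -> eval u (rep (cls t)) = eval u t.
Proof. exact: univ_lift_cls. Qed.

Definition uzero := cls (Tscalar 0).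
Definition uone := cls (Tscalar 1).
Definition uadd x y := cls (Tadd (rep x) (rep y)).
Definition uopp x := cls (Tmul (Tscalar (-1)) (rep x)).
Definition umul x y := cls (Tmul (rep x) (rep y)).
Definition ustar x := cls (Tstar (rep x)).

Ltac usolve :=
  move=> *; apply: univ_ext; let Pu := fresh "Pu" in intros ? ? Pu;
  rewrite /univ_lift;
  do 4![rewrite ?(eval_rep_cls _ Pu) /= ?rmorph1 ?rmorph0 ?rmorphN1 ?mulN1r].

Lemma uaddA : associative uadd. Proof. by usolve; exact: addrA. Qed.
Lemma uaddC : commutative uadd. Proof. by usolve; exact: addrC. Qed.
Lemma uadd0 : left_id uzero uadd. Proof. by usolve; exact: add0r. Qed.
Lemma uaddN : left_inverse uzero uopp uadd.
Proof. by usolve; exact: addNr. Qed.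
Lemma umulA : associative umul. Proof. by usolve; exact: mulrA. Qed.
Lemma umul1l : left_id uone umul. Proof. by usolve; exact: mul1r. Qed.
Lemma umul1r : right_id uone umul. Proof. by usolve; exact: mulr1. Qed.
Lemma umulDl : left_distributive umul uadd.
Proof. by usolve; exact: mulrDl. Qed.
Lemma umulDr : right_distributive umul uadd.
Proof. by usolve; exact: mulrDr. Qed.

HB.instance Definition _ := GRing.isZmodule.Build univ uaddA uaddC uadd0 uaddN.
HB.instance Definition _ :=
  GRing.Zmodule_isPzRing.Build univ umulA umul1l umul1r umulDl umulDr.

Definition usalg (a : C) : univ := cls (Tscalar a).

Lemma usalg_zmod : zmod_morphism usalg.
Proof.
move=> a b; apply: univ_ext => A u Pu; rewrite /univ_lift /=.
by do 4![rewrite ?(eval_rep_cls _ Pu) /= ?rmorphN1 ?mulN1r]; rewrite rmorphB.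
Qed.

Lemma usalg_monoid : monoid_morphism usalg.
Proof.
split=> // a b; apply: univ_ext => A u Pu; rewrite /univ_lift /=.
by do 4![rewrite ?(eval_rep_cls _ Pu) /=]; rewrite rmorphM.
Qed.

HB.instance Definition _ := GRing.isZmodMorphism.Build C univ usalg usalg_zmod.
HB.instance Definition _ :=
  GRing.isMonoidMorphism.Build C univ usalg usalg_monoid.

Lemma usalgC a (x : univ) : usalg a * x = x * usalg a.
Proof. by usolve; exact: salgC. Qed.
Lemma ustarK : involutive ustar. Proof. by usolve; exact: starK. Qed.
Lemma ustarD : {morph ustar : x y / x + y}.
Proof. by usolve; exact: starD. Qed.
Lemma ustarM (x y : univ) : ustar (x * y) = ustar y * ustar x.
Proof. by usolve; exact: starM. Qed.
Lemma ustar_salg a : ustar (usalg a) = usalg a^*.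
Proof. by usolve; exact: star_salg. Qed.

HB.instance Definition _ :=
  isStarAlgebra.Build C univ usalgC ustarK ustarD ustarM ustar_salg.

Definition ugen : 'M[univ]_N := \matrix_(i, j) cls (Tgen i j).

Lemma univ_lift_hom (A : starAlgType C) (u : 'M[A]_N) :
  P u -> star_hom (univ_lift u).
Proof. by move=> Pu; split=> [x y|x y|a|x]; exact: (univ_lift_cls _ Pu). Qed.

Lemma univ_lift_gen (A : starAlgType C) (u : 'M[A]_N) i j :
  P u -> univ_lift u (ugen i j) = u i j.
Proof. by move=> Pu; rewrite mxE univ_lift_cls. Qed.

Lemma cls_eval t : cls t = eval ugen t.
Proof.
elim: t => [i j|a|s hs t ht|s hs t ht|t ht] /=; rewrite ?mxE // -?hs -?ht.
all: apply: cls_ext => A u Pu /=.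
all: by rewrite -?[eval u (rep _)]/(univ_lift u _) ?(univ_lift_cls _ Pu).
Qed.

Lemma univ_lift_uniq (A : starAlgType C) (f g : univ -> A) :
  star_hom f -> star_hom g ->
  (forall i j, f (ugen i j) = g (ugen i j)) -> f =1 g.
Proof.
move=> hf hg fg x; rewrite -(repK x) cls_eval.
elim: (rep x) => [i j|a|s hs t ht|s hs t ht|t ht] //=.
- by rewrite !star_hom_salg.
- by rewrite !star_homD // hs ht.
- by rewrite !star_homM // hs ht.
- by rewrite !star_hom_star // ht.
Qed.

End Universal.

Section Tensor.
Variables (C : numClosedFieldType) (A B : starAlgType C).

Record balanced (V : zmodType) (f : A -> B -> V) : Prop := Balanced {
  balancedDl : forall b, {morph f^~ b : x y / x + y};
  balancedDr : forall a, {morph f a : x y / x + y};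
  balancedZ : forall (c : C) a b, f (salg c * a) b = f a (salg c * b)
}.

Lemma balanced0l (V : zmodType) (f : A -> B -> V) b : balanced f -> f 0 b = 0.
Proof. by move=> hf; apply: (addIr (f 0 b)); rewrite -(balancedDl hf) !add0r. Qed.

Lemma balancedNl (V : zmodType) (f : A -> B -> V) a b :
  balanced f -> f (- a) b = - f a b.
Proof.
by move=> hf; apply/eqP; rewrite -addr_eq0 -(balancedDl hf) addNr balanced0l.
Qed.

Lemma balanced0r (V : zmodType) (f : A -> B -> V) a : balanced f -> f a 0 = 0.
Proof. by move=> hf; apply: (addIr (f a 0)); rewrite -(balancedDr hf) !add0r. Qed.

(* The algebraic tensor product of A and B over C.  A sequence s of pairs
   stands for the sum of the a (x) b for (a, b) in s; two such sums are
   identified when every C-balanced biadditive map gives them the same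
   value. *)
Definition bsum (V : zmodType) (f : A -> B -> V) (s : seq (A * B)) : V :=
  \sum_(p <- s) f p.1 p.2.

Definition tens_eq (s t : seq (A * B)) : bool :=
  `[< forall (V : zmodType) (f : A -> B -> V),
        balanced f -> bsum f s = bsum f t >].

Lemma tens_eq_refl : reflexive tens_eq.
Proof. by move=> s; apply/asboolP. Qed.

Lemma tens_eq_sym : symmetric tens_eq.
Proof. by move=> s t; apply/asboolP/asboolP => h V f bf; rewrite (h _ _ bf). Qed.

Lemma tens_eq_trans : transitive tens_eq.
Proof.
move=> t s r /asboolP h /asboolP k; apply/asboolP => V f bf.
by rewrite (h _ _ bf) (k _ _ bf).
Qed.

Canonical tens_equiv :=
  EquivRel tens_eq tens_eq_refl tens_eq_sym tens_eq_trans.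

Definition tens : Type := {eq_quot tens_eq}.
HB.instance Definition _ := Choice.on tens.

Definition tcls (s : seq (A * B)) : tens := \pi_({eq_quot tens_eq}) s.
Definition trep (x : tens) : seq (A * B) := repr (x : {eq_quot tens_eq}).
Definition tpure (a : A) (b : B) : tens := tcls [:: (a, b)].

Definition tens_lift (V : zmodType) (f : A -> B -> V) (x : tens) : V :=
  bsum f (trep x).

Lemma tens_lift_cls (V : zmodType) (f : A -> B -> V) s :
  balanced f -> tens_lift f (tcls s) = bsum f s.
Proof.
move=> bf; rewrite /tens_lift /trep /tcls.
have /eqmodP/asboolP/(_ V f bf) -> // :
  (repr (\pi_({eq_quot tens_eq}) s) = s %[mod {eq_quot tens_eq}]).
by rewrite reprK.
Qed.

Lemma trepK x : tcls (trep x) = x.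
Proof. exact: reprK. Qed.

Lemma tcls_ext s t :
  (forall (V : zmodType) (f : A -> B -> V),
     balanced f -> bsum f s = bsum f t) -> tcls s = tcls t.
Proof. by move=> h; apply/eqmodP/asboolP. Qed.

Lemma tens_ext (x y : tens) :
  (forall (V : zmodType) (f : A -> B -> V), balanced f ->
     tens_lift f x = tens_lift f y) -> x = y.
Proof. by move=> h; rewrite -(trepK x) -(trepK y); apply: tcls_ext. Qed.

Definition tzero := tcls [::].
Definition tone := tpure 1 1.
Definition tadd x y := tcls (trep x ++ trep y).
Definition topp x := tcls [seq (- p.1, p.2) | p <- trep x].
Definition tmul x y :=
  tcls [seq (p.1 * q.1, p.2 * q.2) | p <- trep x, q <- trep y].
Definition tstar x := tcls [seq (star p.1, star p.2) | p <- trep x].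
Definition tsalg (c : C) := tpure (salg c) 1.

Section Lifts.
Variables (V : zmodType) (f : A -> B -> V).
Hypothesis bf : balanced f.

Lemma tens_lift_pure a b : tens_lift f (tpure a b) = f a b.
Proof. by rewrite tens_lift_cls // /bsum big_seq1. Qed.

Lemma tens_lift_zero : tens_lift f tzero = 0.
Proof. by rewrite tens_lift_cls // /bsum big_nil. Qed.

Lemma tens_lift_add x y :
  tens_lift f (tadd x y) = tens_lift f x + tens_lift f y.
Proof. by rewrite tens_lift_cls // /bsum big_cat. Qed.

Lemma tens_lift_opp x : tens_lift f (topp x) = - tens_lift f x.
Proof.
rewrite tens_lift_cls // /bsum big_map -sumrN.
by apply: eq_bigr => p _; rewrite balancedNl.
Qed.

Lemma balanced_star : balanced (fun a b => f (star a) (star b)).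
Proof.
split=> [b x y|a x y|c a b] /=.
- by rewrite starD (balancedDl bf).
- by rewrite starD (balancedDr bf).
- by rewrite !starM !star_salg -!salgC (balancedZ bf).
Qed.

Lemma tens_lift_star x :
  tens_lift f (tstar x) = tens_lift (fun a b => f (star a) (star b)) x.
Proof. by rewrite tens_lift_cls // /bsum big_map. Qed.

Lemma balanced_mull a0 b0 : balanced (fun a b => f (a0 * a) (b0 * b)).
Proof.
split=> [b x y|a x y|c a b] /=.
- by rewrite mulrDr (balancedDl bf).
- by rewrite mulrDr (balancedDr bf).
- by rewrite !mulrA -!salgC -!mulrA (balancedZ bf).
Qed.

Lemma balanced_mulr y :
  balanced (fun a b => tens_lift (fun a' b' => f (a * a') (b * b')) y).
Proof.
rewrite /tens_lift /bsum; split=> [b x x'|a x x'|c a b] /=.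
- rewrite -big_split; apply: eq_bigr => p _ /=.
  by rewrite mulrDl (balancedDl bf).
- rewrite -big_split; apply: eq_bigr => p _ /=.
  by rewrite mulrDl (balancedDr bf).
- by apply: eq_bigr => p _; rewrite -!mulrA (balancedZ bf).
Qed.

Lemma tens_lift_mul x y : tens_lift f (tmul x y) =
  tens_lift (fun a b => tens_lift (fun a' b' => f (a * a') (b * b')) y) x.
Proof.
rewrite tens_lift_cls // /bsum.
by rewrite /tens_lift /bsum big_allpairs_dep.
Qed.

End Lifts.

Lemma taddA : associative tadd.
Proof. by move=> x y z; apply: tens_ext => V f bf; rewrite !tens_lift_add // addrA. Qed.
Lemma taddC : commutative tadd.
Proof. by move=> x y; apply: tens_ext => V f bf; rewrite !tens_lift_add // addrC. Qed.
Lemma tadd0 : left_id tzero tadd.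
Proof.
by move=> x; apply: tens_ext => V f bf; rewrite tens_lift_add // tens_lift_zero // add0r.
Qed.
Lemma taddN : left_inverse tzero topp tadd.
Proof.
move=> x; apply: tens_ext => V f bf.
by rewrite tens_lift_add // tens_lift_zero // tens_lift_opp // addNr.
Qed.

HB.instance Definition _ := GRing.isZmodule.Build tens taddA taddC tadd0 taddN.

Lemma tens_liftD V f (x y : tens) : @balanced V f ->
  tens_lift f (x + y) = tens_lift f x + tens_lift f y.
Proof. by move=> bf; exact: tens_lift_add. Qed.

Lemma eq_tens_lift (V : zmodType) (f g : A -> B -> V) x :
  f =2 g -> tens_lift f x = tens_lift g x.
Proof. by move=> fg; apply: eq_bigr => p _; exact: fg. Qed.

Lemma tens_lift_sum (V : zmodType) (f g : A -> B -> V) x :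
  tens_lift (fun a b => f a b + g a b) x = tens_lift f x + tens_lift g x.
Proof. exact: big_split. Qed.

Lemma tmulA : associative tmul.
Proof.
move=> x y z; apply: tens_ext => V f bf.
rewrite !tens_lift_mul //; last exact: balanced_mulr.
apply: eq_tens_lift => a b; rewrite tens_lift_mul //; last exact: balanced_mull.
by apply: eq_tens_lift => a' b'; apply: eq_tens_lift => a'' b''; rewrite !mulrA.
Qed.

Lemma tmul1l : left_id tone tmul.
Proof.
move=> x; apply: tens_ext => V f bf; rewrite tens_lift_mul //.
rewrite tens_lift_pure; last exact: balanced_mulr.
by apply: eq_tens_lift => a b; rewrite !mul1r.
Qed.

Lemma tmul1r : right_id tone tmul.
Proof.
move=> x; apply: tens_ext => V f bf; rewrite tens_lift_mul //.
apply: eq_tens_lift => a b; rewrite tens_lift_pure ?mulr1 //.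
exact: balanced_mull.
Qed.

Lemma tmulDl : left_distributive tmul +%R.
Proof.
move=> x y z; apply: tens_ext => V f bf.
by rewrite tens_liftD // !tens_lift_mul // tens_liftD //; exact: balanced_mulr.
Qed.

Lemma tmulDr : right_distributive tmul +%R.
Proof.
move=> x y z; apply: tens_ext => V f bf.
rewrite tens_liftD // !tens_lift_mul // -tens_lift_sum.
by apply: eq_tens_lift => a b; rewrite tens_liftD //; exact: balanced_mull.
Qed.

HB.instance Definition _ :=
  GRing.Zmodule_isPzRing.Build tens tmulA tmul1l tmul1r tmulDl tmulDr.

Lemma tpureDl b : {morph tpure^~ b : x y / x + y}.
Proof.
move=> x y; apply: tens_ext => V f bf.
by rewrite tens_liftD // !tens_lift_pure // (balancedDl bf).
Qed.

Lemma tpureDr a : {morph tpure a : x y / x + y}.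
Proof.
move=> x y; apply: tens_ext => V f bf.
by rewrite tens_liftD // !tens_lift_pure // (balancedDr bf).
Qed.

Lemma tpureZ (c : C) a b : tpure (salg c * a) b = tpure a (salg c * b).
Proof.
by apply: tens_ext => V f bf; rewrite !tens_lift_pure // (balancedZ bf).
Qed.

Lemma tpure_balanced : balanced tpure.
Proof. by split; [exact: tpureDl | exact: tpureDr | exact: tpureZ]. Qed.

Lemma tpureM a b a' b' : tpure a b * tpure a' b' = tpure (a * a') (b * b').
Proof.
apply: tens_ext => V f bf; rewrite tens_lift_mul // !tens_lift_pure //.
  exact: balanced_mull.
exact: balanced_mulr.
Qed.

Lemma tpure_sum (x : tens) : x = \sum_(p <- trep x) tpure p.1 p.2.
Proof.
apply: tens_ext => V f bf; rewrite {1}/tens_lift /bsum.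
elim: (trep x) => [|p s ih]; first by rewrite !big_nil tens_lift_zero.
by rewrite !big_cons tens_liftD // tens_lift_pure // ih.
Qed.

Lemma tsalg_zmod : zmod_morphism tsalg.
Proof.
move=> a b; apply/eqP; rewrite eq_sym subr_eq; apply/eqP.
by rewrite /tsalg -tpureDl -rmorphD subrK.
Qed.

Lemma tsalg_monoid : monoid_morphism tsalg.
Proof.
by split=> [|a b]; rewrite /tsalg ?rmorph1 // tpureM rmorphM mulr1.
Qed.

HB.instance Definition _ := GRing.isZmodMorphism.Build C tens tsalg tsalg_zmod.
HB.instance Definition _ :=
  GRing.isMonoidMorphism.Build C tens tsalg tsalg_monoid.

Lemma tsalgC c (x : tens) : tsalg c * x = x * tsalg c.
Proof.
rewrite [x]tpure_sum mulr_sumr mulr_suml; apply: eq_bigr => p _.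
by rewrite !tpureM salgC mul1r mulr1.
Qed.

Lemma tstar_pure a b : tstar (tpure a b) = tpure (star a) (star b).
Proof.
apply: tens_ext => V f bf; rewrite tens_lift_star // !tens_lift_pure //.
exact: balanced_star.
Qed.

Lemma tstarD : {morph tstar : x y / x + y}.
Proof.
move=> x y; apply: tens_ext => V f bf.
rewrite tens_liftD // !tens_lift_star // tens_liftD //.
exact: balanced_star.
Qed.

Lemma tstar0 : tstar 0 = 0.
Proof. by apply: (addIr (tstar 0)); rewrite -tstarD !add0r. Qed.

Lemma tstar_sum (x : tens) :
  tstar x = \sum_(p <- trep x) tpure (star p.1) (star p.2).
Proof.
rewrite [x in LHS]tpure_sum (big_morph _ tstarD tstar0).
by apply: eq_bigr => p _; rewrite tstar_pure.
Qed.

Lemma tstarK : involutive tstar.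
Proof.
move=> x; rewrite [tstar x]tstar_sum (big_morph _ tstarD tstar0).
by rewrite [RHS]tpure_sum; apply: eq_bigr => p _; rewrite tstar_pure !starK.
Qed.

Lemma tstarM (x y : tens) : tstar (x * y) = tstar y * tstar x.
Proof.
rewrite [x in LHS]tpure_sum [y in LHS]tpure_sum (tstar_sum x) (tstar_sum y).
rewrite [in LHS]mulr_suml [in LHS](big_morph _ tstarD tstar0) mulr_sumr.
apply: eq_bigr => p _.
rewrite [in LHS]mulr_sumr [in LHS](big_morph _ tstarD tstar0) mulr_suml.
by apply: eq_bigr => q _; rewrite !tpureM tstar_pure !starM.
Qed.

Lemma tstar_salg c : tstar (tsalg c) = tsalg c^*.
Proof. by rewrite /tsalg tstar_pure star_salg star1. Qed.

HB.instance Definition _ :=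
  isStarAlgebra.Build C tens tsalgC tstarK tstarD tstarM tstar_salg.

End Tensor.

Definition tens_map (C : numClosedFieldType) (A B A' B' : starAlgType C)
    (f : A -> A') (g : B -> B') : tens A B -> tens A' B' :=
  tens_lift (fun a b => tpure (f a) (g b)).

(* A compact quantum group, given by its *-algebra and comultiplication: the
   data which isomorphisms of quantum groups refer to. *)
Record qgroup (C : numClosedFieldType) := QGroup {
  qalg : starAlgType C;
  qcomul : qalg -> tens qalg qalg;
  qcomul_hom : star_hom qcomul
}.

Definition qgroup_iso (C : numClosedFieldType) (G K : qgroup C) : Prop :=
  exists f : qalg G -> qalg K,
    [/\ star_hom f, bijective f
      & forall x, qcomul (f x) = tens_map f f (qcomul x)].

Section Presented.
Variable C : numClosedFieldType.

Definition adjmx (A : starAlgType C) m n (u : 'M[A]_(m, n)) : 'M[A]_(n, m) :=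
  \matrix_(i, j) star (u j i).

Lemma adjmxE (A : starAlgType C) m n (u : 'M[A]_(m, n)) i j :
  adjmx u i j = star (u j i).
Proof. exact: mxE. Qed.

Definition comulmx (A B : starAlgType C) n (u : 'M[A]_n) (v : 'M[B]_n) :
    'M[tens A B]_n :=
  \matrix_(i, j) \sum_k tpure (u i k) (v k j).

Definition comul_stable N (P : relations C N) : Prop :=
  forall (A B : starAlgType C) (u : 'M[A]_N) (v : 'M[B]_N),
    P A u -> P B v -> P (tens A B) (comulmx u v).

Definition presented_qgroup N (P : relations C N)
    (Pgen : P (univ P) (ugen P)) (Pmul : comul_stable P) : qgroup C :=
  QGroup (univ_lift_hom (Pmul _ _ _ _ Pgen Pgen)).

Section TensorTheory.
Variables A B : starAlgType C.

Lemma tpure_suml I (r : seq I) (P : pred I) (F : I -> A) (b : B) :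
  tpure (\sum_(i <- r | P i) F i) b = \sum_(i <- r | P i) tpure (F i) b.
Proof.
apply: (big_morph (fun a => tpure a b)); first exact: tpureDl.
exact: balanced0l (@tpure_balanced _ A B).
Qed.

Lemma tpure_sumr I (r : seq I) (P : pred I) (a : A) (F : I -> B) :
  tpure a (\sum_(i <- r | P i) F i) = \sum_(i <- r | P i) tpure a (F i).
Proof.
apply: (big_morph (tpure a)); first exact: tpureDr.
exact: balanced0r (@tpure_balanced _ A B).
Qed.

Lemma tpureNl (a : A) (b : B) : tpure (- a) b = - tpure a b.
Proof. exact: balancedNl (@tpure_balanced _ A B). Qed.

Lemma tpureNr (a : A) (b : B) : tpure a (- b) = - tpure a b.
Proof.
apply/eqP; rewrite -addr_eq0 -tpureDr addNr.
by rewrite (balanced0r _ (@tpure_balanced _ A B)).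
Qed.

Lemma tpure_prod n (F : 'I_n -> A) (G : 'I_n -> B) :
  \prod_i tpure (F i) (G i) = tpure (\prod_i F i) (\prod_i G i).
Proof.
elim: n F G => [|n ih] F G; first by rewrite !big_ord0.
by rewrite !big_ord_recl ih tpureM.
Qed.

Lemma star_tpure (a : A) (b : B) : star (tpure a b) = tpure (star a) (star b).
Proof. exact: tstar_pure. Qed.

Lemma salg_tpure (c : C) (a : A) (b : B) : salg c * tpure a b = tpure (salg c * a) b.
Proof. by rewrite [salg c](_ : _ = tpure (salg c) 1) // tpureM mul1r. Qed.

Lemma tpure_salg (c : C) (a : A) (b : B) : tpure a b * salg c = tpure a (b * salg c).
Proof. by rewrite -salgC salg_tpure tpureZ salgC. Qed.

Lemma comulmx_inv n (u u' : 'M[A]_n) (v v' : 'M[B]_n) (x' : 'M[tens A B]_n) :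
  (forall i j, x' i j = \sum_k tpure (u' k j) (v' i k)) ->
  u *m u' = 1%:M -> u' *m u = 1%:M -> v *m v' = 1%:M -> v' *m v = 1%:M ->
  comulmx u v *m x' = 1%:M /\ x' *m comulmx u v = 1%:M.
Proof.
move=> x'E uu' u'u vv' v'v; split; apply/matrixP => i j; rewrite !mxE.
- transitivity (\sum_a \sum_b tpure (u i a * u' b j) ((v *m v') a b)).
    rewrite (eq_bigr (fun k => \sum_a \sum_b
      tpure (u i a * u' b j) (v a k * v' k b))); last first.
      move=> k _; rewrite mxE x'E mulr_suml; apply: eq_bigr => a _.
      by rewrite mulr_sumr; apply: eq_bigr => b _; rewrite tpureM.
    rewrite exchange_big; apply: eq_bigr => a _.
    rewrite exchange_big; apply: eq_bigr => b _.
    by rewrite mxE tpure_sumr.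
  rewrite vv' (eq_bigr (fun a => tpure (u i a * u' a j) 1)); last first.
    move=> a _; rewrite (bigD1 a) //= big1 ?addr0 ?mxE ?eqxx // => b ba.
    by rewrite mxE eq_sym (negPf ba) (balanced0r _ (@tpure_balanced _ A B)).
  rewrite -tpure_suml; have := congr1 (fun m : 'M_(_, _) => m i j) uu'; rewrite !mxE => ->.
  by case: eqP => _ //; rewrite (balanced0l _ (@tpure_balanced _ A B)).
- transitivity (\sum_b \sum_a tpure ((u' *m u) b a) (v' i b * v a j)).
    rewrite (eq_bigr (fun k => \sum_b \sum_a
      tpure (u' b k * u k a) (v' i b * v a j))); last first.
      move=> k _; rewrite mxE x'E mulr_suml; apply: eq_bigr => b _.
      by rewrite mulr_sumr; apply: eq_bigr => a _; rewrite tpureM.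
    rewrite exchange_big; apply: eq_bigr => b _.
    rewrite exchange_big; apply: eq_bigr => a _.
    by rewrite mxE tpure_suml.
  rewrite u'u (eq_bigr (fun b => tpure 1 (v' i b * v b j))); last first.
    move=> b _; rewrite (bigD1 b) //= big1 ?addr0 ?mxE ?eqxx // => a ab.
    by rewrite mxE eq_sym (negPf ab) (balanced0l _ (@tpure_balanced _ A B)).
  rewrite -tpure_sumr; have := congr1 (fun m : 'M_(_, _) => m i j) v'v; rewrite !mxE => ->.
  by case: eqP => _ //; rewrite (balanced0r _ (@tpure_balanced _ A B)).
Qed.

End TensorTheory.
End Presented.

Section ConcreteCategory.
Variables (C : numClosedFieldType) (N : nat).

(* Multi-indices: the canonical basis of the k-th tensor power of C^N. *)
Definition mindex (k : nat) : Type := {ffun 'I_k -> 'I_N}.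

(* A linear map from the k-th to the l-th tensor power of C^N, by its matrix
   entries T y x (row y, column x). *)
Definition lin (k l : nat) : Type := mindex l -> mindex k -> C.

Definition tpow (R : pzRingType) (u : 'M[R]_N) k (y x : mindex k) : R :=
  \prod_(i < k) u (y i) (x i).

Definition cat_rel (K : forall k l, lin k l -> Prop) : relations C N :=
  fun A u =>
    [/\ u *m adjmx u = 1%:M,
        adjmx u *m u = 1%:M
      & forall k l (T : lin k l), K k l T -> forall y x,
          \sum_(z : mindex k) salg (T y z) * tpow u z x =
          \sum_(z : mindex l) tpow u y z * salg (T z x)].

Variable K : forall k l, lin k l -> Prop.

Lemma cat_rel_gen : cat_rel K (ugen (cat_rel K)).
Proof.
split.
- apply/matrixP => i j; apply: univ_ext => A u Pu.
  have hf := univ_lift_hom Pu; have [uu _ _] := Pu.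
  have := congr1 (fun m : 'M_(_, _) => m i j) uu; rewrite /= !mxE (star_hom_sum hf) => e.
  transitivity (\sum_j0 u i j0 * adjmx u j0 j).
    apply: eq_bigr => a _.
    by rewrite (star_homM hf) !adjmxE (star_hom_star hf) !(univ_lift_gen _ _ Pu).
  by rewrite e; case: eqP; rewrite ?(star_hom1 hf) ?(star_hom0 hf).
- apply/matrixP => i j; apply: univ_ext => A u Pu.
  have hf := univ_lift_hom Pu; have [_ uu _] := Pu.
  have := congr1 (fun m : 'M_(_, _) => m i j) uu; rewrite /= !mxE (star_hom_sum hf) => e.
  transitivity (\sum_j0 adjmx u i j0 * u j0 j).
    apply: eq_bigr => a _.
    by rewrite (star_homM hf) !adjmxE (star_hom_star hf) !(univ_lift_gen _ _ Pu).
  by rewrite e; case: eqP; rewrite ?(star_hom1 hf) ?(star_hom0 hf).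
- move=> k l T KT y x; apply: univ_ext => A u Pu.
  have hf := univ_lift_hom Pu; have [_ _ /(_ k l T KT y x)] := Pu.
  have tE m (z w : mindex m) :
      univ_lift u (tpow (ugen (cat_rel K)) z w) = tpow u z w.
    rewrite (star_hom_prod hf); apply: eq_bigr => i _.
    exact: univ_lift_gen.
  rewrite !(star_hom_sum hf) => e.
  under eq_bigr do rewrite (star_homM hf) (star_hom_salg hf) tE.
  by under [RHS]eq_bigr do rewrite (star_homM hf) (star_hom_salg hf) tE.
Qed.

Lemma tpow_comulmx (A B : starAlgType C) (u : 'M[A]_N) (v : 'M[B]_N) k
    (y x : mindex k) :
  tpow (comulmx u v) y x = \sum_(z : mindex k) tpure (tpow u y z) (tpow v z x).
Proof.
rewrite /tpow; under eq_bigr do rewrite mxE.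
by rewrite bigA_distr_bigA; apply: eq_bigr => z _; rewrite tpure_prod.
Qed.

Lemma cat_rel_comul : comul_stable (cat_rel K).
Proof.
move=> A B u v [uu' u'u uT] [vv' v'v vT].
have [] := @comulmx_inv _ A B N u (adjmx u) v (adjmx v) (adjmx (comulmx u v)) _
  uu' u'u vv' v'v.
  move=> i j; rewrite !mxE star_sum; apply: eq_bigr => a _.
  by rewrite !mxE star_tpure.
move=> xx' x'x; split=> // k l T KT y x.
transitivity (\sum_(m : mindex k) \sum_(n : mindex l)
    tpure (tpow u y n) (salg (T n m) * tpow v m x)).
  under eq_bigr do rewrite tpow_comulmx mulr_sumr.
  rewrite exchange_big; apply: eq_bigr => m _.
  under eq_bigr do rewrite salg_tpure.
  rewrite -tpure_suml (uT _ _ _ KT) tpure_suml; apply: eq_bigr => n _.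
  by rewrite -salgC tpureZ.
rewrite exchange_big; under [RHS]eq_bigr do rewrite tpow_comulmx mulr_suml.
rewrite [RHS]exchange_big; apply: eq_bigr => n _.
under [RHS]eq_bigr do rewrite tpure_salg.
by rewrite -!tpure_sumr (vT _ _ _ KT).
Qed.

(* The quantum group corresponding to a concrete category with hom-sets K. *)
Definition cat_qgroup : qgroup C :=
  presented_qgroup cat_rel_gen cat_rel_comul.

End ConcreteCategory.

Section SOminus.
Variable C : numClosedFieldType.

Definition SOm1_rel : relations C 4 := fun A u =>
  [/\ [/\ forall i j, star (u i j) = u i j, u *m u^T = 1%:M & u^T *m u = 1%:M],
      forall i k l, k != l -> u i k * u i l = - (u i l * u i k),
      forall i k l, k != l -> u k i * u l i = - (u l i * u k i),
      forall i j k l, i != j -> k != l -> u i k * u j l = u j l * u i k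
    & \sum_(s : 'S_4) \prod_(i < 4) u i (s i) = 1].

Lemma SOm1_rel_gen : SOm1_rel (ugen SOm1_rel).
Proof.
split.
- split.
  + move=> i j; apply: univ_ext => A u Pu.
    rewrite (star_hom_star (univ_lift_hom Pu)) (univ_lift_gen _ _ Pu).
    by case: Pu => [[]].
  + apply/matrixP => i j; apply: univ_ext => A u Pu.
    have hf := univ_lift_hom Pu; have [[_ uu _] _ _ _ _] := Pu.
    have := congr1 (fun m : 'M_(_, _) => m i j) uu.
    rewrite /= !mxE (star_hom_sum hf) => e.
    transitivity (\sum_k u i k * u^T k j).
      by apply: eq_bigr => a _; rewrite (star_homM hf) !mxE !(univ_lift_cls _ Pu).
    by rewrite e; case: eqP; rewrite ?(star_hom1 hf) ?(star_hom0 hf).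
  + apply/matrixP => i j; apply: univ_ext => A u Pu.
    have hf := univ_lift_hom Pu; have [[_ _ uu] _ _ _ _] := Pu.
    have := congr1 (fun m : 'M_(_, _) => m i j) uu.
    rewrite /= !mxE (star_hom_sum hf) => e.
    transitivity (\sum_k u^T i k * u k j).
      by apply: eq_bigr => a _; rewrite (star_homM hf) !mxE !(univ_lift_cls _ Pu).
    by rewrite e; case: eqP; rewrite ?(star_hom1 hf) ?(star_hom0 hf).
- move=> i k l kl; apply: univ_ext => A u Pu; have hf := univ_lift_hom Pu.
  rewrite (star_homN hf) !(star_homM hf) !(univ_lift_gen _ _ Pu).
  by case: Pu => _ h _ _ _; exact: h.
- move=> i k l kl; apply: univ_ext => A u Pu; have hf := univ_lift_hom Pu.
  rewrite (star_homN hf) !(star_homM hf) !(univ_lift_gen _ _ Pu).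
  by case: Pu => _ _ h _ _; exact: h.
- move=> i j k l ij kl; apply: univ_ext => A u Pu; have hf := univ_lift_hom Pu.
  rewrite !(star_homM hf) !(univ_lift_gen _ _ Pu).
  by case: Pu => _ _ _ h _; exact: h.
- apply: univ_ext => A u Pu; have hf := univ_lift_hom Pu.
  rewrite (star_hom_sum hf) (star_hom1 hf); case: (Pu) => _ _ _ _ <-.
  apply: eq_bigr => s _; rewrite (star_hom_prod hf).
  by apply: eq_bigr => i _; rewrite (univ_lift_gen _ _ Pu).
Qed.

Section Det.
Variables (A : starAlgType C) (v : 'M[A]_4).
Hypothesis hv : SOm1_rel v.

Let D (k : 'I_4 -> 'I_4) : A := \sum_(s : 'S_4) \prod_(i < 4) v (k i) (s i).

Let adj (a b : 'I_4) := (b == a.+1 :> nat).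

(* The ordered product, split around two adjacent positions. *)
Lemma prod_adj (a b : 'I_4) : adj a b -> exists (L R : ('I_4 -> A) -> A),
  (forall F G, (forall i, i != a -> i != b -> F i = G i) -> L F = L G /\ R F = R G) /\
  (forall F, \prod_(i < 4) F i = L F * (F a * F b) * R F).
Proof.
case: a => -[|[|[|[|//]]]] ?; case: b => -[|[|[|[|//]]]] ? //= _.
- exists (fun=> 1), (fun F => F (inord 2) * F (inord 3)); split=> [F G FG|F].
    by rewrite !FG // -val_eqE /= inordK.
  rewrite !big_ord_recl big_ord0 !mulr1 mul1r !mulrA.
  by congr (F _ * F _ * F _ * F _); apply: val_inj; rewrite /= ?inordK.
- exists (fun F => F (inord 0)), (fun F => F (inord 3)); split=> [F G FG|F].
    by rewrite !FG // -val_eqE /= inordK.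
  rewrite !big_ord_recl big_ord0 !mulr1 !mulrA.
  by congr (F _ * F _ * F _ * F _); apply: val_inj; rewrite /= ?inordK.
- exists (fun F => F (inord 0) * F (inord 1)), (fun=> 1); split=> [F G FG|F].
    by rewrite !FG // -val_eqE /= inordK.
  rewrite !big_ord_recl big_ord0 !mulr1 !mulrA.
  by congr (F _ * F _ * F _ * F _); apply: val_inj; rewrite /= ?inordK.
Qed.

Lemma adj_neq a b : adj a b -> a != b.
Proof. by rewrite /adj -val_eqE /= => /eqP ->; rewrite neq_ltn ltnSn. Qed.

Lemma D_adj (a b : 'I_4) k : adj a b -> D (k \o tperm a b) = D k.
Proof.
move=> ab; have [kab|kab] := eqVneq (k a) (k b).
  apply: eq_bigr => s _; apply: eq_bigr => i _ /=.
  by congr (v _ _); case: tpermP => [->|->|].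
rewrite /D (reindex_inj (mulgI (tperm a b))); apply: eq_bigr => s _.
have [L [R [LR]]] := prod_adj ab => LRE; rewrite !LRE /=.
rewrite !permM tpermL tpermR; case: hv => _ _ _ vC _.
have sab : s a != s b by rewrite (inj_eq perm_inj) adj_neq.
rewrite (vC (k b)) 1?eq_sym // .
by have [|-> ->] := LR (fun i => v (k (tperm a b i)) ((tperm a b * s)%g i))
  (fun i => v (k i) (s i)) => // i ia ib; rewrite permM tpermD // eq_sym.
Qed.

Lemma two_eq0 (x : A) : x = - x -> x = 0.
Proof.
move=> /eqP; rewrite -subr_eq0 opprK => /eqP xx.
have x2 : salg (2%:R : C) * x = 0 by rewrite rmorph_nat mulr_natl mulr2n xx.
rewrite -[x]mul1r -(rmorph1 salg) -(@mulVf C 2%:R) ?pnatr_eq0 //.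
by rewrite rmorphM -mulrA x2 mulr0.
Qed.

Lemma D_adj0 (a b : 'I_4) k : adj a b -> k a = k b -> D k = 0.
Proof.
move=> ab kab; apply: two_eq0.
rewrite {1}/D (reindex_inj (mulgI (tperm a b))) /D -sumrN; apply: eq_bigr => s _.
have [L [R [LR]]] := prod_adj ab => LRE; rewrite !LRE /=.
rewrite !permM tpermL tpermR; case: hv => _ vR _ _ _.
have sab : s a != s b by rewrite (inj_eq perm_inj) adj_neq.
rewrite kab (vR (k b) (s b)) 1?eq_sym // mulrN mulNr.
by have [|-> ->] := LR (fun i => v (k i) ((tperm a b * s)%g i))
  (fun i => v (k i) (s i)) => // i ia ib; rewrite permM tpermD // eq_sym.
Qed.

Lemma eq_D k k' : k =1 k' -> D k = D k'.
Proof. by move=> kk; apply: eq_bigr => s _; apply: eq_bigr => i _; rewrite kk. Qed.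

Let inv (p : 'S_4) := forall k, D (k \o p) = D k.

Lemma invM p q : inv p -> inv q -> inv (p * q)%g.
Proof.
move=> hp hq k; rewrite -(hq k) -(hp (k \o q)).
by apply: eq_D => i; rewrite /= permM.
Qed.

Lemma inv_tperm_lt (n : nat) (a b : 'I_4) :
  b = (a + n.+1)%N :> nat -> inv (tperm a b).
Proof.
elim: n b => [|n ih] b ban.
  by move=> k; apply: D_adj; rewrite /adj ban addn1.
have c4 : (a + n.+1 < 4)%N.
  by rewrite -ltnS -addnS -ban; apply: ltn_trans (ltn_ord b) _.
pose c := Ordinal c4.
have cb : adj c b by rewrite /adj /= ban addnS.
have nab : a != b by rewrite -val_eqE /= ban -[X in X != _]addn0 eqn_add2l.
have nac : a != c by rewrite -val_eqE /= -[X in X != _]addn0 eqn_add2l.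
have -> : tperm a b = (tperm c b * tperm a c * tperm c b)%g.
  have := tpermJ a c (tperm c b); rewrite tpermL tpermD 1?eq_sym //.
  by rewrite /conjg tpermV mulgA => ->.
have icb : inv (tperm c b) by move=> k; apply: D_adj.
by apply: invM => //; apply: invM => //; apply: ih.
Qed.

Lemma inv_tperm (a b : 'I_4) : a != b -> inv (tperm a b).
Proof.
rewrite -val_eqE neq_ltn => /orP[] lt.
  by apply: (@inv_tperm_lt (b - a).-1); rewrite prednK ?subn_gt0 ?subnKC // ltnW.
rewrite tpermC.
by apply: (@inv_tperm_lt (a - b).-1); rewrite prednK ?subn_gt0 ?subnKC // ltnW.
Qed.

Lemma D_perm p : inv p.
Proof.
have [ts -> ts_dpair] := prod_tpermP p.
elim: ts ts_dpair => [_|t ts ih /= /andP[td tsd]] /=.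
  by rewrite big_nil => k; apply: eq_D => i; rewrite /= perm1.
rewrite big_cons; apply: invM; last exact: ih.
exact: inv_tperm.
Qed.

Lemma D_inj (k : 'S_4) : D k = 1.
Proof.
by transitivity (D id); [exact: (D_perm k id) | case: hv].
Qed.

Lemma D_ninj (a b : 'I_4) k : a != b -> k a = k b -> D k = 0.
Proof.
wlog lt : a b / (a < b)%N => [hw ab kab|_ kab].
  by move: (ab); rewrite -val_eqE neq_ltn => /orP[] lt;
     [exact: (hw a b) | apply: (hw b a); rewrite 1?eq_sym].
have c4 : (a.+1 < 4)%N by apply: leq_ltn_trans lt (ltn_ord b).
pose c := Ordinal c4.
rewrite -(D_perm (tperm c b) k); apply: (@D_adj0 a c) => //=; first by rewrite /adj.
rewrite tpermL; have [<-|bc] := eqVneq b c; first by rewrite tperm1 perm1.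
rewrite tpermD // -val_eqE /=; first by rewrite eq_sym neq_ltn ltnSn.
by rewrite eq_sym neq_ltn lt.
Qed.

Lemma D_ffun (k : {ffun 'I_4 -> 'I_4}) :
  \sum_(s : 'S_4) \prod_(i < 4) v (k i) (s i) = (injectiveb k)%:R.
Proof.
case: injectiveP => [kinj|kinj].
  transitivity (D (perm kinj)); last exact: D_inj.
  by apply: eq_bigr => s _; apply: eq_bigr => i _; rewrite permE.
have /injectivePn[a [b ab kab]] : ~~ injectiveb k by apply/injectiveP.
exact: (D_ninj ab kab).
Qed.

End Det.

Lemma SOm1_rel_comul : comul_stable SOm1_rel.
Proof.
move=> A B u v hu hv.
have [[us uu' u'u] uR uK uC udet] := hu; have [[vs vv' v'v] vR vK vC vdet] := hv.
have [] := @comulmx_inv _ A B 4 u u^T v v^T (comulmx u v)^T _ uu' u'u vv' v'v.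
  by move=> i j; rewrite !mxE; apply: eq_bigr => k _; rewrite !mxE.
move=> xx' x'x.
have xM i k j l : comulmx u v i k * comulmx u v j l =
    \sum_a \sum_b tpure (u i a * u j b) (v a k * v b l).
  rewrite !mxE mulr_suml; apply: eq_bigr => a _.
  by rewrite mulr_sumr; apply: eq_bigr => b _; rewrite tpureM.
split; first split=> //.
- move=> i j; rewrite mxE star_sum; apply: eq_bigr => k _.
  by rewrite star_tpure us vs.
- move=> i k l kl; rewrite !xM exchange_big -sumrN; apply: eq_bigr => b _.
  rewrite -sumrN; apply: eq_bigr => a _; have [<-|ab] := eqVneq a b.
    by rewrite (vR _ _ _ kl) tpureNr.
  by rewrite (uR _ _ _ ab) (vC _ _ _ _ ab kl) tpureNl.
- move=> i k l kl; rewrite !xM exchange_big -sumrN; apply: eq_bigr => b _.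
  rewrite -sumrN; apply: eq_bigr => a _; have [<-|ab] := eqVneq a b.
    by rewrite (uK _ _ _ kl) tpureNl.
  by rewrite (uC _ _ _ _ kl ab) (vK _ _ _ ab) tpureNr.
- move=> i j k l ij kl; rewrite !xM exchange_big; apply: eq_bigr => b _.
  apply: eq_bigr => a _; have [<-|ab] := eqVneq a b.
    by rewrite (uK _ _ _ ij) (vR _ _ _ kl) tpureNl tpureNr opprK.
  by rewrite (uC _ _ _ _ ij ab) (vC _ _ _ _ ab kl).
- transitivity (\sum_(k : {ffun 'I_4 -> 'I_4})
      tpure (\prod_i u i (k i)) ((injectiveb k)%:R : B)).
    transitivity (\sum_(s : 'S_4) \sum_(k : {ffun 'I_4 -> 'I_4})
        \prod_i tpure (u i (k i)) (v (k i) (s i))).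
      apply: eq_bigr => s _; rewrite -(bigA_distr_bigA
        (fun i k => tpure (u i k) (v k (s i)))).
      by apply: eq_bigr => i _; rewrite mxE.
    rewrite exchange_big; apply: eq_bigr => k _; rewrite -(D_ffun hv) tpure_sumr.
    by apply: eq_bigr => s _; rewrite tpure_prod.
  rewrite (bigID (fun k : {ffun 'I_4 -> 'I_4} => injectiveb k)) /=.
  rewrite [X in _ + X]big1 ?addr0; last first.
    by move=> k /negPf ->; rewrite (balanced0r _ (@tpure_balanced _ A B)).
  rewrite (reindex_onto (@pval _) (insubd (1%g : 'S_4))) /=; last first.
    by move=> k kinj; rewrite insubdK.
  rewrite (eq_bigl xpredT) /=; last first.
    by move=> s; rewrite (valP s) /=; apply/eqP; exact: valKd.
  under eq_bigr => s _ do rewrite (valP s).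
  rewrite -tpure_suml [X in tpure X _](_ : _ = 1) //; rewrite -[RHS]udet.
  by apply: eq_bigr => s _; apply: eq_bigr => i _; rewrite pvalE.
Qed.

(* The anticommutative deformation of SO(4). *)
Definition SOm1_4 : qgroup C := presented_qgroup SOm1_rel_gen SOm1_rel_comul.

End SOminus.

Section NCBipart.
Variable C : numClosedFieldType.

(* Black stands for the generators b_(k, l), White for the w_(k, l). *)
Inductive color := Black | White.

(* Formal morphisms k -> l.  Ncomp g f is g after f. *)
Inductive ncmor : nat -> nat -> Type :=
| Nid k : ncmor k k
| Ngen (s : color) k l : ncmor k l
| Nzero k l : ncmor k l
| Nadd k l of ncmor k l & ncmor k l : ncmor k l
| Nscale k l of C & ncmor k l : ncmor k l
| Ncomp k l m of ncmor l m & ncmor k l : ncmor k m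
| Ntens k1 l1 k2 l2 of ncmor k1 l1 & ncmor k2 l2 : ncmor (k1 + k2) (l1 + l2)
| Ndag k l of ncmor k l : ncmor l k.

Definition ncast k l k' l' (ek : k = k') (el : l = l') (f : ncmor k l) :
    ncmor k' l' :=
  ecast k (ncmor k l') ek (ecast l (ncmor k l) el f).

(* Equality of morphisms in NCBipart_delta: the least congruence containing
   the axioms of strict monoidal C-linear dagger categories and the defining
   relations.  Strictness identifies the objects k + (l + m) and (k + l) + m
   along addnA, and k + 0 with k along addn0.  Rigidity needs no further
   morphisms: nc_spider and nc_id make (Ngen s 0 2, Ngen s 2 0) a solution of
   the zig-zag equations for the object 1. *)
Inductive nceq (delta : C) : forall k l, ncmor k l -> ncmor k l -> Prop :=
| nc_refl k l (f : ncmor k l) : nceq delta f f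
| nc_sym k l (f g : ncmor k l) : nceq delta f g -> nceq delta g f
| nc_trans k l (f g h : ncmor k l) :
    nceq delta f g -> nceq delta g h -> nceq delta f h
| nc_add k l (f f' g g' : ncmor k l) : nceq delta f f' -> nceq delta g g' ->
    nceq delta (Nadd f g) (Nadd f' g')
| nc_scale k l c (f f' : ncmor k l) : nceq delta f f' ->
    nceq delta (Nscale c f) (Nscale c f')
| nc_comp k l m (g g' : ncmor l m) (f f' : ncmor k l) :
    nceq delta g g' -> nceq delta f f' -> nceq delta (Ncomp g f) (Ncomp g' f')
| nc_tens k1 l1 k2 l2 (f f' : ncmor k1 l1) (g g' : ncmor k2 l2) :
    nceq delta f f' -> nceq delta g g' -> nceq delta (Ntens f g) (Ntens f' g')
| nc_dag k l (f f' : ncmor k l) : nceq delta f f' ->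
    nceq delta (Ndag f) (Ndag f')
| nc_addA k l (f g h : ncmor k l) :
    nceq delta (Nadd f (Nadd g h)) (Nadd (Nadd f g) h)
| nc_addC k l (f g : ncmor k l) : nceq delta (Nadd f g) (Nadd g f)
| nc_add0 k l (f : ncmor k l) : nceq delta (Nadd (Nzero k l) f) f
| nc_addN k l (f : ncmor k l) : nceq delta (Nadd (Nscale (-1) f) f) (Nzero k l)
| nc_scaleA k l a c (f : ncmor k l) :
    nceq delta (Nscale a (Nscale c f)) (Nscale (a * c) f)
| nc_scale1 k l (f : ncmor k l) : nceq delta (Nscale 1 f) f
| nc_scaleDr k l c (f g : ncmor k l) :
    nceq delta (Nscale c (Nadd f g)) (Nadd (Nscale c f) (Nscale c g))
| nc_scaleDl k l a c (f : ncmor k l) :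
    nceq delta (Nscale (a + c) f) (Nadd (Nscale a f) (Nscale c f))
| nc_compA k l m n (h : ncmor m n) (g : ncmor l m) (f : ncmor k l) :
    nceq delta (Ncomp h (Ncomp g f)) (Ncomp (Ncomp h g) f)
| nc_idl k l (f : ncmor k l) : nceq delta (Ncomp (Nid l) f) f
| nc_idr k l (f : ncmor k l) : nceq delta (Ncomp f (Nid k)) f
| nc_compDl k l m (g g' : ncmor l m) (f : ncmor k l) :
    nceq delta (Ncomp (Nadd g g') f) (Nadd (Ncomp g f) (Ncomp g' f))
| nc_compDr k l m (g : ncmor l m) (f f' : ncmor k l) :
    nceq delta (Ncomp g (Nadd f f')) (Nadd (Ncomp g f) (Ncomp g f'))
| nc_compZl k l m c (g : ncmor l m) (f : ncmor k l) :
    nceq delta (Ncomp (Nscale c g) f) (Nscale c (Ncomp g f))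
| nc_compZr k l m c (g : ncmor l m) (f : ncmor k l) :
    nceq delta (Ncomp g (Nscale c f)) (Nscale c (Ncomp g f))
| nc_tensA k1 l1 k2 l2 k3 l3
    (f : ncmor k1 l1) (g : ncmor k2 l2) (h : ncmor k3 l3) :
    nceq delta (ncast (addnA k1 k2 k3) (addnA l1 l2 l3) (Ntens f (Ntens g h)))
               (Ntens (Ntens f g) h)
| nc_tens0l k l (f : ncmor k l) : nceq delta (Ntens (Nid 0) f) f
| nc_tens0r k l (f : ncmor k l) :
    nceq delta (ncast (addn0 k) (addn0 l) (Ntens f (Nid 0))) f
| nc_tens_id k l : nceq delta (Ntens (Nid k) (Nid l)) (Nid (k + l))
| nc_tens_comp k1 l1 m1 k2 l2 m2 (g : ncmor l1 m1) (f : ncmor k1 l1)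
    (g' : ncmor l2 m2) (f' : ncmor k2 l2) :
    nceq delta (Ntens (Ncomp g f) (Ncomp g' f'))
               (Ncomp (Ntens g g') (Ntens f f'))
| nc_tensDl k1 l1 k2 l2 (f f' : ncmor k1 l1) (g : ncmor k2 l2) :
    nceq delta (Ntens (Nadd f f') g) (Nadd (Ntens f g) (Ntens f' g))
| nc_tensDr k1 l1 k2 l2 (f : ncmor k1 l1) (g g' : ncmor k2 l2) :
    nceq delta (Ntens f (Nadd g g')) (Nadd (Ntens f g) (Ntens f g'))
| nc_tensZl k1 l1 k2 l2 c (f : ncmor k1 l1) (g : ncmor k2 l2) :
    nceq delta (Ntens (Nscale c f) g) (Nscale c (Ntens f g))
| nc_tensZr k1 l1 k2 l2 c (f : ncmor k1 l1) (g : ncmor k2 l2) :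
    nceq delta (Ntens f (Nscale c g)) (Nscale c (Ntens f g))
| nc_dagK k l (f : ncmor k l) : nceq delta (Ndag (Ndag f)) f
| nc_dag_id k : nceq delta (Ndag (Nid k)) (Nid k)
| nc_dag_comp k l m (g : ncmor l m) (f : ncmor k l) :
    nceq delta (Ndag (Ncomp g f)) (Ncomp (Ndag f) (Ndag g))
| nc_dag_tens k1 l1 k2 l2 (f : ncmor k1 l1) (g : ncmor k2 l2) :
    nceq delta (Ndag (Ntens f g)) (Ntens (Ndag f) (Ndag g))
| nc_dagD k l (f g : ncmor k l) :
    nceq delta (Ndag (Nadd f g)) (Nadd (Ndag f) (Ndag g))
| nc_dagZ k l c (f : ncmor k l) :
    nceq delta (Ndag (Nscale c f)) (Nscale c^* (Ndag f))
(* The relations obtained from the following by the dagger are consequences,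
   by nc_dag. *)
| nc_dag_gen s k l : nceq delta (Ndag (Ngen s k l)) (Ngen s l k)
| nc_id s : nceq delta (Ngen s 1 1) (Nid 1)
| nc_loop s : nceq delta (Ngen s 0 0) (Nscale delta (Nid 0))
| nc_spider s k1 k2 l1 l2 m : (0 < m)%N ->
    nceq delta
      (Ncomp (Ntens (Ngen s (k1 + m) l1) (Nid l2))
             (ncast erefl (addnA k1 m l2)
                    (Ntens (Nid k1) (Ngen s k2 (m + l2)))))
      (Ngen s (k1 + k2) (l1 + l2))
| nc_cup : nceq delta (Ngen Black 0 2) (Ngen White 0 2)
| nc_bw : nceq delta (Ncomp (Ngen Black 2 1) (Ngen White 1 2))
                     (Nscale delta^-1 (Ncomp (Ngen Black 0 1) (Ngen White 1 0))).

(* Hom-sets of NCBipartEven_delta, as subsets of those of NCBipart_delta. *)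
Inductive NCBipartEven (delta : C) : forall k l, ncmor k l -> Prop :=
| even_eq k l (f g : ncmor k l) :
    nceq delta f g -> NCBipartEven delta f -> NCBipartEven delta g
| even_b22 : NCBipartEven delta (Ngen Black 2 2)
| even_w22 : NCBipartEven delta (Ngen White 2 2)
| even_b20 : NCBipartEven delta (Ngen Black 2 0)
| even_id k : NCBipartEven delta (Nid k)
| even_zero k l : NCBipartEven delta (Nzero k l)
| even_add k l (f g : ncmor k l) : NCBipartEven delta f ->
    NCBipartEven delta g -> NCBipartEven delta (Nadd f g)
| even_scale k l c (f : ncmor k l) :
    NCBipartEven delta f -> NCBipartEven delta (Nscale c f)
| even_comp k l m (g : ncmor l m) (f : ncmor k l) : NCBipartEven delta g ->
    NCBipartEven delta f -> NCBipartEven delta (Ncomp g f)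
| even_tens k1 l1 k2 l2 (f : ncmor k1 l1) (g : ncmor k2 l2) :
    NCBipartEven delta f -> NCBipartEven delta g ->
    NCBipartEven delta (Ntens f g)
| even_dag k l (f : ncmor k l) :
    NCBipartEven delta f -> NCBipartEven delta (Ndag f).

End NCBipart.

Section LinearMaps.
Variables (C : numClosedFieldType) (N : nat).
Local Notation mindex := (mindex N).
Local Notation lin := (lin C N).

Definition mleft k l (y : mindex (k + l)) : mindex k :=
  [ffun i => y (lshift l i)].
Definition mright k l (y : mindex (k + l)) : mindex l :=
  [ffun i => y (rshift k i)].

Definition lid k : lin k k := fun y x => (y == x)%:R.
Definition lcomp k l m (g : lin l m) (f : lin k l) : lin k m :=
  fun z x => \sum_(y : mindex l) g z y * f y x.
Definition ltens k1 l1 k2 l2 (f : lin k1 l1) (g : lin k2 l2) :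
    lin (k1 + k2) (l1 + l2) :=
  fun y x => f (mleft y) (mleft x) * g (mright y) (mright x).
Definition ldag k l (f : lin k l) : lin l k := fun x y => (f y x)^*.

(* The maps T_(k, l); the case k + l = 0 is not covered by the entrywise rule. *)
Definition spider k l : lin k l := fun y x =>
  if (k + l == 0)%N then N%:R
  else [exists i, [forall a, y a == i] && [forall a, x a == i]]%:R.

Definition hadamard (H : 'M[C]_N) : Prop :=
  [/\ forall i j, H i j = 1 \/ H i j = -1,
      H *m H^T = N%:R%:M & H^T *m H = N%:R%:M].

Variable H : 'M[C]_N.

Definition wspider k l : lin k l := fun y x =>
  sqrtC N%:R ^- (k + l) *
  lcomp (@tpow N C H^T l) (lcomp (@spider k l) (@tpow N C H k)) y x.

Fixpoint FH k l (f : ncmor C k l) : lin k l :=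
  match f with
  | Nid k => @lid k
  | Ngen Black k l => @spider k l
  | Ngen White k l => @wspider k l
  | Nzero _ _ => fun _ _ => 0
  | Nadd _ _ f g => fun y x => FH f y x + FH g y x
  | Nscale _ _ c f => fun y x => c * FH f y x
  | Ncomp _ _ _ g f => lcomp (FH g) (FH f)
  | Ntens _ _ _ _ f g => ltens (FH f) (FH g)
  | Ndag _ _ f => ldag (FH f)
  end.

(* The image under F_H of a family of hom-sets. *)
Definition FH_image (K : forall k l, ncmor C k l -> Prop) k l (T : lin k l) :
    Prop :=
  exists2 f : ncmor C k l, K k l f & T = FH f.

(* The lemmas below lead to FH_sound: for a Hadamard matrix, FH respects nceq,
   hence defines a functor on NCBipart_N. *)

Definition mcat k l (y : mindex k) (x : mindex l) : mindex (k + l) :=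
  [ffun i => match split i with inl a => y a | inr b => x b end].

Lemma mleft_cat k l (y : mindex k) (x : mindex l) : mleft (mcat y x) = y.
Proof.
by apply/ffunP => i; rewrite !ffunE (unsplitK (inl i)).
Qed.

Lemma mright_cat k l (y : mindex k) (x : mindex l) : mright (mcat y x) = x.
Proof.
by apply/ffunP => i; rewrite !ffunE (unsplitK (inr i)).
Qed.

Lemma mcat_lr k l (y : mindex (k + l)) : mcat (mleft y) (mright y) = y.
Proof.
by apply/ffunP => i; rewrite ffunE; case: splitP => j ij;
   rewrite ffunE; congr (y _); apply: val_inj.
Qed.

Lemma sum_mcat k l (F : mindex (k + l) -> C) :
  \sum_y F y = \sum_(y : mindex k) \sum_(x : mindex l) F (mcat y x).
Proof.
rewrite pair_big /=; apply: (reindex (fun p => mcat p.1 p.2)).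
exists (fun y => (mleft y, mright y)) => [[y x] _|y _] /=.
  by rewrite mleft_cat mright_cat.
by rewrite mcat_lr.
Qed.

Lemma lin_ext k l (f g : lin k l) : (forall y x, f y x = g y x) -> f = g.
Proof. by move=> fg; apply/funext => y; apply/funext => x. Qed.

Definition mcast k k' (e : k = k') (y : mindex k) : mindex k' :=
  [ffun i => y (cast_ord (esym e) i)].

Lemma mcast_id k (e : k = k) y : mcast e y = y.
Proof. by apply/ffunP => i; rewrite ffunE cast_ord_id. Qed.

Lemma FH_cast k l k' l' (ek : k = k') (el : l = l') (f : ncmor C k l) y x :
  FH (ncast ek el f) y x = FH f (mcast (esym el) y) (mcast (esym ek) x).
Proof. by case: _ / ek x; case: _ / el y => y x; rewrite !mcast_id. Qed.

Section Assoc.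
Variables (k l m : nat) (e : (k + l + m = k + (l + m))%N).
Variable y : mindex (k + l + m).
Lemma mleft_cast : mleft (mcast e y) = mleft (mleft y).
Proof. by apply/ffunP => i; rewrite !ffunE; congr (y _); apply: val_inj. Qed.
Lemma mleft_right_cast : mleft (mright (mcast e y)) = mright (mleft y).
Proof. by apply/ffunP => i; rewrite !ffunE; congr (y _); apply: val_inj. Qed.
Lemma mright_cast : mright (mright (mcast e y)) = mright y.
Proof.
by apply/ffunP => i; rewrite !ffunE; congr (y _); apply: val_inj; rewrite /= addnA.
Qed.
End Assoc.

Lemma lcompA k l m n (h : lin m n) (g : lin l m) (f : lin k l) :
  lcomp h (lcomp g f) = lcomp (lcomp h g) f.
Proof.
apply: lin_ext => y x; rewrite /lcomp.
under eq_bigr do rewrite mulr_sumr.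
rewrite exchange_big; apply: eq_bigr => z _; rewrite mulr_suml.
by apply: eq_bigr => w _; rewrite mulrA.
Qed.

Lemma lcomp_idl k l (f : lin k l) : lcomp (@lid l) f = f.
Proof.
apply: lin_ext => y x; rewrite /lcomp (bigD1 y) //= big1 => [|z zy].
  by rewrite /lid eqxx mul1r addr0.
by rewrite /lid eq_sym (negPf zy) mul0r.
Qed.

Lemma lcomp_idr k l (f : lin k l) : lcomp f (@lid k) = f.
Proof.
apply: lin_ext => y x; rewrite /lcomp (bigD1 x) //= big1 => [|z zy].
  by rewrite /lid eqxx mulr1 addr0.
by rewrite /lid (negPf zy) mulr0.
Qed.

Lemma ltens_comp k1 l1 m1 k2 l2 m2 (g : lin l1 m1) (f : lin k1 l1)
    (g' : lin l2 m2) (f' : lin k2 l2) :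
  ltens (lcomp g f) (lcomp g' f') = lcomp (ltens g g') (ltens f f').
Proof.
apply: lin_ext => y x; rewrite /ltens /lcomp sum_mcat mulr_suml.
apply: eq_bigr => a _; rewrite mulr_sumr; apply: eq_bigr => b _.
by rewrite mleft_cat mright_cat mulrACA.
Qed.

Lemma ltens_id k l : ltens (@lid k) (@lid l) = @lid (k + l).
Proof.
apply: lin_ext => y x; rewrite /ltens /lid -natrM mulnb; congr (nat_of_bool _)%:R.
apply/andP/eqP => [[/eqP yl /eqP yr]|-> //].
by rewrite -(mcat_lr y) yl yr mcat_lr.
Qed.

Lemma mindex0 (y x : mindex 0) : y = x.
Proof. by apply/ffunP => -[]. Qed.

(* Both colors are given by an orthonormal basis phi with real entries. *)
Definition gspider (phi : 'I_N -> 'I_N -> C) k l : lin k l := fun y x =>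
  \sum_i (\prod_a phi i (y a)) * (\prod_a phi i (x a)).

Lemma prod_delta k (y : mindex k) i :
  \prod_a ((y a == i)%:R : C) = [forall a, y a == i]%:R.
Proof.
case: forallP => h; first by rewrite big1 // => a _; rewrite (eqP (h a)) eqxx.
have /existsP[a ya] : [exists a, y a != i].
  by rewrite -negb_forall; apply/forallP.
by rewrite (bigD1 a) //= (negPf ya) mul0r.
Qed.

Lemma spiderE k l : @spider k l = gspider (fun i j => (j == i)%:R) (l := l).
Proof.
apply: lin_ext => y x; rewrite /spider /gspider.
under eq_bigr do rewrite !prod_delta -natrM mulnb.
have [|kl] := ifPn.
  rewrite addn_eq0 => /andP[/eqP k0 /eqP l0].
  rewrite (eq_bigr (fun=> 1)) ?sumr_const ?card_ord // => i _.
  rewrite (_ : _ && _) //; apply/andP; split; apply/forallP => -[a ha].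
    by exfalso; rewrite l0 in ha.
  by exfalso; rewrite k0 in ha.
case: existsP => [[i hi]|h]; last first.
  by rewrite big1 // => i _; case: (boolP (_ && _)) => // hi; case: h; exists i.
rewrite (bigD1 i) //= hi big1 ?addr0 // => j ji.
case: (boolP (_ && _)) => // /andP[/forallP hy /forallP hx].
case/andP: hi => /forallP iy /forallP ix; case/eqP: ji.
case: k l y x kl hy hx iy ix => [|k] [|l] // y x _ hy hx iy ix.
- by rewrite -(eqP (hy ord0)) (eqP (iy ord0)).
- by rewrite -(eqP (hx ord0)) (eqP (ix ord0)).
- by rewrite -(eqP (hx ord0)) (eqP (ix ord0)).
Qed.

Section Orthonormal.
Variable phi : 'I_N -> 'I_N -> C.
Hypothesis phi_row : forall i j, \sum_a phi i a * phi j a = (i == j)%:R.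
Hypothesis phi_col : forall a b, \sum_i phi i a * phi i b = (a == b)%:R.
Hypothesis phi_real : forall i j, (phi i j)^* = phi i j.

Lemma sum_phi m i j : \sum_(q : mindex m)
  (\prod_a phi i (q a)) * (\prod_a phi j (q a)) = (i == j)%:R ^+ m.
Proof.
under eq_bigr do rewrite -big_split /=.
rewrite -(bigA_distr_bigA (fun _ a => phi i a * phi j a)) /=.
by under eq_bigr do rewrite phi_row; rewrite prodr_const card_ord.
Qed.

Lemma gspider11 : @gspider phi 1 1 = @lid 1.
Proof.
apply: lin_ext => y x; rewrite /gspider /lid.
under eq_bigr do rewrite !big_ord1; rewrite phi_col; congr (nat_of_bool _)%:R.
apply/eqP/eqP => [h|->//]; apply/ffunP => i; by rewrite !ord1.
Qed.

Lemma gspider00 y x : @gspider phi 0 0 y x = N%:R.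
Proof.
rewrite /gspider; under eq_bigr do rewrite !big_ord0 mulr1.
by rewrite sumr_const card_ord.
Qed.

Lemma gspider_dag k l : ldag (@gspider phi k l) = @gspider phi l k.
Proof.
apply: lin_ext => y x; rewrite /ldag /gspider rmorph_sum; apply: eq_bigr => i _.
rewrite rmorphM !rmorph_prod mulrC; congr (_ * _); apply: eq_bigr => a _;
  exact: phi_real.
Qed.

Lemma prod_mcat k l (y : mindex (k + l)) i : \prod_a phi i (y a) =
  (\prod_a phi i (mleft y a)) * (\prod_a phi i (mright y a)).
Proof.
rewrite big_split_ord; congr (_ * _); apply: eq_bigr => a _;
by rewrite ffunE.
Qed.

Lemma gspider_fuse k1 k2 l1 l2 m y x : (0 < m)%N ->
  lcomp (ltens (@gspider phi (k1 + m) l1) (@lid l2))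
    (fun y x => ltens (@lid k1) (@gspider phi k2 (m + l2))
                  (mcast (esym (addnA k1 m l2)) y) x) y x =
  @gspider phi (k1 + k2) (l1 + l2) y x.
Proof.
move=> m0.
pose P k (z : mindex k) i := \prod_a phi i (z a).
transitivity (\sum_(q : mindex m)
    (\sum_i P _ (mleft y) i * (P _ (mleft x) i * P _ q i)) *
    (\sum_j (P _ q j * P _ (mright y) j) * P _ (mright x) j)).
  rewrite /lcomp !sum_mcat (bigD1 (mleft x)) //= [X in _ + X]big1 ?addr0.
    apply: eq_bigr => q _; rewrite (bigD1 (mright y)) //= [X in _ + X]big1 ?addr0.
      rewrite /ltens /lid mleft_cast !(mleft_cat, mright_cat) !eqxx mulr1 mul1r.
      rewrite /gspider; congr (_ * _); apply: eq_bigr => i _; rewrite prod_mcat.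
        by rewrite !(mleft_cat, mright_cat).
      by rewrite mleft_right_cast mright_cast !(mleft_cat, mright_cat).
    move=> r ry; rewrite /ltens /lid !(mleft_cat, mright_cat).
    by rewrite eq_sym (negPf ry) mulr0 mul0r.
  move=> p px; rewrite big1 // => q _; rewrite big1 // => r _.
  by rewrite /ltens /lid mleft_cast !mleft_cat (negPf px) mul0r mulr0.
transitivity (\sum_i \sum_j (P _ (mleft y) i * P _ (mleft x) i *
    (P _ (mright y) j * P _ (mright x) j)) * (i == j)%:R).
  under eq_bigr do rewrite mulr_suml.
  rewrite exchange_big; apply: eq_bigr => i _.
  under eq_bigr do rewrite mulr_sumr.
  rewrite exchange_big; apply: eq_bigr => j _.
  rewrite (_ : (i == j)%:R = (i == j)%:R ^+ m); last first.
    by case: eqP; rewrite ?expr1n // expr0n -[m]prednK.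
  rewrite -sum_phi mulr_sumr; apply: eq_bigr => q _.
  by rewrite -/(P _ q i) -/(P _ q j); ring.
apply: eq_bigr => i _; rewrite (bigD1 i) //= big1 ?addr0 => [|j ji].
  by rewrite eqxx mulr1 (prod_mcat y) (prod_mcat x) mulrACA /P; ring.
by rewrite eq_sym (negPf ji) mulr0.
Qed.

End Orthonormal.
Definition black (i j : 'I_N) : C := (j == i)%:R.
Definition white (i j : 'I_N) : C := H i j / sqrtC N%:R.

Lemma black_row i j : \sum_a black i a * black j a = (i == j)%:R.
Proof.
rewrite (bigD1 i) //= big1 ?addr0 => [|a ai]; first by rewrite /black eqxx mul1r.
by rewrite /black (negPf ai) mul0r.
Qed.

Lemma black_col a b : \sum_i black i a * black i b = (a == b)%:R.
Proof.
rewrite (bigD1 a) //= big1 ?addr0 => [|i ia].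
  by rewrite /black eqxx mul1r eq_sym.
by rewrite /black eq_sym (negPf ia) mul0r.
Qed.

Lemma black_real i j : (black i j)^* = black i j.
Proof. by rewrite /black conjC_nat. Qed.

Lemma wspiderE k l : @wspider k l = gspider white (l := l).
Proof.
apply: lin_ext => y x; rewrite /wspider spiderE.
have cE n (M : 'I_n -> 'I_N -> C) i :
    \sum_(z : mindex n) (\prod_a M a (z a)) * (\prod_a black i (z a)) =
    \prod_a M a i.
  transitivity (\sum_(z : mindex n) \prod_a (M a (z a) * black i (z a))).
    by apply: eq_bigr => z _; rewrite big_split.
  rewrite -(bigA_distr_bigA (fun a c => M a c * black i c)) /=.
  apply: eq_bigr => a _; rewrite (bigD1 i) //= big1 ?addr0 => [|c ci].
    by rewrite /black eqxx mulr1.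
  by rewrite /black (negPf ci) mulr0.
have -> : lcomp (@tpow N C H^T l) (lcomp (@gspider black k l) (@tpow N C H k)) y x
    = \sum_i (\prod_a H i (y a)) * (\prod_a H i (x a)).
  rewrite /lcomp /gspider.
  transitivity (\sum_i (\sum_(z : mindex l)
      (\prod_a H^T (y a) (z a)) * (\prod_a black i (z a))) *
    (\sum_(z : mindex k) (\prod_a H (z a) (x a)) * (\prod_a black i (z a)))).
    under eq_bigr do (under eq_bigr do rewrite mulr_suml; rewrite exchange_big mulr_sumr).
    rewrite exchange_big; apply: eq_bigr => i _; rewrite mulr_suml.
    apply: eq_bigr => z _; rewrite !mulr_sumr; apply: eq_bigr => w _.
    by rewrite /tpow; ring.
  apply: eq_bigr => i _; rewrite (cE _ (fun a c => H^T (y a) c)).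
  rewrite (cE _ (fun a c => H c (x a))).
  by congr (_ * _); apply: eq_bigr => a _; rewrite mxE.
rewrite mulr_sumr /gspider /white; apply: eq_bigr => i _; rewrite !big_split /=.
by rewrite !prodr_const !card_ord exprD invfM -!exprVn; ring.
Qed.

Lemma sum_fuse (Z : finType) (a e : 'I_N -> C) (b d : 'I_N -> Z -> C) :
  \sum_z (\sum_c a c * b c z) * (\sum_j d j z * e j) =
  \sum_c \sum_j a c * e j * \sum_z b c z * d j z.
Proof.
under eq_bigr do rewrite mulr_suml.
rewrite exchange_big; apply: eq_bigr => c _.
under eq_bigr do rewrite mulr_sumr.
rewrite exchange_big; apply: eq_bigr => j _; rewrite mulr_sumr.
by apply: eq_bigr => z _; ring.
Qed.

Section Soundness.
Hypothesis hH : hadamard H.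

Let sqrtN : sqrtC N%:R * sqrtC N%:R = N%:R :> C.
Proof. by rewrite -expr2 sqrtCK. Qed.

Let natN0 (i : 'I_N) : N%:R != 0 :> C.
Proof. by rewrite pnatr_eq0 -lt0n (leq_ltn_trans _ (ltn_ord i)). Qed.

Lemma white_row i j : \sum_a white i a * white j a = (i == j)%:R.
Proof.
have [_ /(congr1 (fun M : 'M_(_, _) => M i j)) + _] := hH; rewrite !mxE => HH.
transitivity ((\sum_a H i a * H^T a j) / N%:R).
  rewrite mulr_suml; apply: eq_bigr => a _; rewrite /white mxE.
  by rewrite mulrACA -invfM sqrtN.
by rewrite HH; case: eqP => _; rewrite ?mul0r // divff ?(natN0 i).
Qed.

Lemma white_col a b : \sum_i white i a * white i b = (a == b)%:R.
Proof.
have [_ _ /(congr1 (fun M : 'M_(_, _) => M a b))] := hH; rewrite !mxE => HH.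
transitivity ((\sum_i H^T a i * H i b) / N%:R).
  rewrite mulr_suml; apply: eq_bigr => i _; rewrite /white mxE.
  by rewrite mulrACA -invfM sqrtN.
by rewrite HH; case: eqP => _; rewrite ?mul0r // divff ?(natN0 a).
Qed.

Lemma white_real i j : (white i j)^* = white i j.
Proof.
have [/(_ i j) h _ _] := hH; rewrite /white rmorphM fmorphV /=.
have s_ge0 : 0 <= sqrtC (N%:R : C) by rewrite sqrtC_ge0 ler0n.
by rewrite (geC0_conj s_ge0); case: h => ->; rewrite ?rmorphN ?rmorph1.
Qed.

Lemma white_sq i j : white i j * white i j = N%:R^-1.
Proof.
have [/(_ i j) h _ _] := hH; rewrite /white mulrACA -invfM sqrtN.
by case: h => ->; rewrite ?mulrNN !mul1r.
Qed.

Definition basis (s : color) := if s is Black then black else white.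

Lemma FH_gen s k l : FH (Ngen C s k l) = @gspider (basis s) k l.
Proof. by case: s; [exact: spiderE | exact: wspiderE]. Qed.

Lemma basis_row s i j : \sum_a basis s i a * basis s j a = (i == j)%:R.
Proof. by case: s; [exact: black_row | exact: white_row]. Qed.
Lemma basis_col s a b : \sum_i basis s i a * basis s i b = (a == b)%:R.
Proof. by case: s; [exact: black_col | exact: white_col]. Qed.
Lemma basis_real s i j : (basis s i j)^* = basis s i j.
Proof. by case: s; [exact: black_real | exact: white_real]. Qed.

Lemma FH_sound k l (f g : ncmor C k l) : nceq N%:R f g -> FH f = FH g.
Proof.
elim=> {k l f g}.
- by [].
- by [].
- by move=> k l f g h _ -> _ ->.
- by move=> k l f f' g g' _ /= -> _ ->.
- by move=> k l c f f' _ /= ->.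
- by move=> k l m g g' f f' _ /= -> _ ->.
- by move=> k1 l1 k2 l2 f f' g g' _ /= -> _ ->.
- by move=> k l f f' _ /= ->.
- by move=> k l f g h; apply: lin_ext => y x /=; rewrite addrA.
- by move=> k l f g; apply: lin_ext => y x /=; rewrite addrC.
- by move=> k l f; apply: lin_ext => y x /=; rewrite add0r.
- by move=> k l f; apply: lin_ext => y x /=; rewrite mulN1r addNr.
- by move=> k l a c f; apply: lin_ext => y x /=; rewrite mulrA.
- by move=> k l f; apply: lin_ext => y x /=; rewrite mul1r.
- by move=> k l c f g; apply: lin_ext => y x /=; rewrite mulrDr.
- by move=> k l a c f; apply: lin_ext => y x /=; rewrite mulrDl.
- by move=> k l m n h g f /=; exact: lcompA.
- by move=> k l f /=; exact: lcomp_idl.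
- by move=> k l f /=; exact: lcomp_idr.
- move=> k l m g g' f; apply: lin_ext => y x /=; rewrite /lcomp -big_split /=.
  by apply: eq_bigr => z _; rewrite mulrDl.
- move=> k l m g f f'; apply: lin_ext => y x /=; rewrite /lcomp -big_split /=.
  by apply: eq_bigr => z _; rewrite mulrDr.
- move=> k l m c g f; apply: lin_ext => y x /=; rewrite /lcomp mulr_sumr.
  by apply: eq_bigr => z _; rewrite mulrA.
- move=> k l m c g f; apply: lin_ext => y x /=; rewrite /lcomp mulr_sumr.
  by apply: eq_bigr => z _; rewrite mulrCA.
- move=> k1 l1 k2 l2 k3 l3 f g h; apply: lin_ext => y x.
  rewrite FH_cast /= /ltens !mleft_cast !mleft_right_cast !mright_cast.
  by rewrite mulrA.
- move=> k l f; apply: lin_ext => y x /=; rewrite /ltens /lid.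
  rewrite (mindex0 (mleft y) (mleft x)) eqxx mul1r; congr (FH f _ _);
  by apply/ffunP => i; rewrite ffunE; congr (_ _); apply: val_inj.
- move=> k l f; apply: lin_ext => y x; rewrite FH_cast /= /ltens /lid.
  set y' := mcast _ y; set x' := mcast _ x.
  rewrite (mindex0 (mright y') (mright x')) eqxx mulr1; congr (FH f _ _);
  by apply/ffunP => i; rewrite !ffunE; congr (_ _); apply: val_inj.
- by move=> k l /=; exact: ltens_id.
- by move=> k1 l1 m1 k2 l2 m2 g f g' f' /=; exact: ltens_comp.
- by move=> k1 l1 k2 l2 f f' g; apply: lin_ext => y x; rewrite /= /ltens mulrDl.
- by move=> k1 l1 k2 l2 f g g'; apply: lin_ext => y x; rewrite /= /ltens mulrDr.
- by move=> k1 l1 k2 l2 c f g; apply: lin_ext => y x; rewrite /= /ltens mulrA.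
- by move=> k1 l1 k2 l2 c f g; apply: lin_ext => y x; rewrite /= /ltens mulrCA.
- by move=> k l f; apply: lin_ext => y x /=; rewrite /ldag conjCK.
- by move=> k; apply: lin_ext => y x /=; rewrite /ldag /lid conjC_nat eq_sym.
- move=> k l m g f; apply: lin_ext => y x /=; rewrite /ldag /lcomp rmorph_sum.
  by apply: eq_bigr => z _; rewrite rmorphM mulrC.
- by move=> k1 l1 k2 l2 f g; apply: lin_ext => y x; rewrite /= /ldag /ltens rmorphM.
- by move=> k l f g; apply: lin_ext => y x; rewrite /= /ldag rmorphD.
- by move=> k l c f; apply: lin_ext => y x; rewrite /= /ldag rmorphM.
- move=> s k l; rewrite FH_gen -(gspider_dag (basis_real s)) -FH_gen.
  by case: s.
- by move=> s; rewrite FH_gen (gspider11 (basis_col s)).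
- move=> s; rewrite FH_gen; apply: lin_ext => y x; rewrite gspider00 /=.
  by rewrite /lid (mindex0 y x) eqxx mulr1.
- move=> s k1 k2 l1 l2 m m0; apply: lin_ext => y x.
  rewrite FH_gen -(gspider_fuse (basis_row s) _ _ m0).
  transitivity (lcomp (ltens (FH (Ngen C s (k1 + m) l1)) (@lid l2))
    (FH (ncast erefl (addnA k1 m l2) (Ntens (Nid C k1) (Ngen C s k2 (m + l2)))))
    y x) => //.
  rewrite FH_gen; apply: eq_bigr => z _; congr (_ * _).
  rewrite FH_cast (mcast_id (esym erefl) x).
  by rewrite -[@gspider _ k2 (m + l2)]FH_gen.
- rewrite !FH_gen; apply: lin_ext => y x; rewrite /gspider.
  under eq_bigr do rewrite big_ord0 mulr1 !big_ord_recl big_ord0 mulr1.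
  under [RHS]eq_bigr do rewrite big_ord0 mulr1 !big_ord_recl big_ord0 mulr1.
  by rewrite black_col white_col.
- apply: lin_ext => y x.
  transitivity (lcomp (FH (Ngen C Black 2 1)) (FH (Ngen C White 1 2)) y x) => //.
  transitivity (N%:R^-1 *
    lcomp (FH (Ngen C Black 0 1)) (FH (Ngen C White 1 0)) y x) => //.
  rewrite !FH_gen /lcomp.
  transitivity (N%:R^-1 * \sum_j white j (x ord0)).
    have cE c : \prod_(a < 1) black c (y a) = (y ord0 == c)%:R by rewrite big_ord1.
    transitivity (\sum_c \sum_j (y ord0 == c)%:R * white j (x ord0) *
        \sum_(z : mindex 2) (\prod_a black c (z a)) * (\prod_a white j (z a))).
      rewrite /gspider /= sum_fuse; apply: eq_bigr => c _.
      by apply: eq_bigr => j _; rewrite cE big_ord1.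
    rewrite (bigD1 (y ord0)) //= [X in _ + X]big1 ?addr0 => [|c cy]; last first.
      by rewrite big1 // => j _; rewrite eq_sym (negPf cy) !mul0r.
    rewrite mulr_sumr; apply: eq_bigr => j _; rewrite eqxx mul1r mulrC.
    congr (_ * _); rewrite -(white_sq j (y ord0)).
    transitivity (\sum_(z : mindex 2)
      \prod_(a < 2) (black (y ord0) (z a) * white j (z a))).
      by apply: eq_bigr => z _; exact: (esym (big_split _ _ _ _ _)).
    rewrite -(bigA_distr_bigA (fun _ c => black (y ord0) c * white j c)) /=.
    rewrite !big_ord_recl big_ord0 mulr1.
    rewrite (bigD1 (y ord0)) //= big1 ?addr0 => [|c cy].
      by rewrite /black eqxx mul1r.
    by rewrite /black (negPf cy) mul0r.
  congr (_ * _); rewrite /gspider /= sum_fuse exchange_big; apply: eq_bigr => j _.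
  rewrite (bigD1 (y ord0)) //= [X in _ + X]big1 ?addr0 => [|c cy]; last first.
    by rewrite big_ord1 /black eq_sym (negPf cy) !mul0r.
  rewrite !big_ord1 /black eqxx mul1r.
  rewrite (eq_bigr (fun=> 1)) => [|z _]; last by rewrite !big_ord0 mulr1.
  by rewrite sumr_const cardT /= -cardE card_ffun !card_ord mulr1.
Qed.

End Soundness.
End LinearMaps.

(* Main.v *)
Require Import Defs.
From mathcomp Require Import all_boot all_order all_algebra.
From mathcomp Require Import perm ring reals complex.

Set Implicit Arguments.
Unset Strict Implicit.
Unset Printing Implicit Defensive.

Import Order.TTheory GRing.Theory Num.Theory.
Local Open Scope ring_scope.

(** Both algebras are presented by the entries of a real orthogonal 4 x 4
    matrix, and an orthogonal change of basis of C^4 carries one set of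
    relations to the other.

    On the categorical side, put W := H / 2, an orthogonal matrix all of whose
    entries square to 1/4.  The cap b_(2,0) makes u real orthogonal, and b_(2,2)
    and w_(2,2) add that u (x) u commutes with the orthogonal projections onto
    the span of the e (x) e, where e runs through the standard basis or through
    the rows of W respectively.  Nothing else is imposed, since intertwiners
    whose adjoint is an intertwiner are stable under all operations of the
    category (cat_relP).  The coefficients of such a projection are those of
    quartic phi, phi being the basis; commuting with it means that u, written
    in the basis phi, has pairwise orthogonal entries in the sense that ab = 0
    for distinct entries in the same row or column (commutes_quartic), and this
    second form shows at once how the condition moves under a change of basis.

    The change of basis comes from mutually unbiased bases.  Change the sign of
    the first coordinate of every row of W: the resulting basis M is unbiased
    both to the standard basis and to W.  Seen from M, the two given bases
    therefore have all entries of square 1/4.  For such a basis the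
    coefficients of the projection are forced (quartic_flat): they are
    pairing / 4, plus a constant times distinct, where pairing lives on index
    quadruples whose entries agree in pairs and distinct is the indicator of
    quadruples without repetition.  The constant is the sum over the basis of
    the product of the coordinates.  It is 4 p for the standard basis, where p
    is the product of the entries of any column of W, and - 4 p for W, which
    seen from M is the Householder reflection 1 - 2 w w^T in the first column w
    of W.  So commuting with both projections is the same as commuting with
    pairing and with distinct (commutes_mub).

    These are exactly the relations of SO_4^(-1) for v := M u M^T.  Commuting
    with pairing is the anticommutation rule for entries in a common row or
    column together with the commutation rule for all others
    (commutes_pairing).  Commuting with distinct, a twisted Hodge star on
    two-tensors, is by orthogonality the same as fixing the four-tensor with
    coefficients distinct, that is, as the determinant relation
    (commutes_distinct).  Hence cat_rel u holds if and only if
    SOm1_rel (M u M^T) does, and conjugation by a real orthogonal scalar matrix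
    respects the comultiplication (presented_qgroup_iso). *)

(** * Star homomorphisms and tensor products *)

Section StarHom.
Variable C : numClosedFieldType.

Lemma star_hom_id (A : starAlgType C) : star_hom (@id A).
Proof. by split. Qed.

Lemma star_hom_comp (A B D : starAlgType C) (g : B -> D) (f : A -> B) :
  star_hom g -> star_hom f -> star_hom (g \o f).
Proof.
move=> hg hf; split=> [x y|x y|a|x] /=.
- by rewrite (star_homD hf) (star_homD hg).
- by rewrite (star_homM hf) (star_homM hg).
- by rewrite (star_hom_salg hf) (star_hom_salg hg).
- by rewrite (star_hom_star hf) (star_hom_star hg).
Qed.

Section TensMap.
Variables (A B A' B' : starAlgType C) (f : A -> A') (g : B -> B').
Hypotheses (hf : star_hom f) (hg : star_hom g).

Lemma balanced_tens_map : balanced (fun a b => tpure (f a) (g b)).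
Proof.
split=> [b x y|a x y|c a b].
- by rewrite (star_homD hf) tpureDl.
- by rewrite (star_homD hg) tpureDr.
- rewrite (star_homM hf) (star_homM hg) (star_hom_salg hf) (star_hom_salg hg).
  exact: tpureZ.
Qed.

Lemma tens_map_pure a b : tens_map f g (tpure a b) = tpure (f a) (g b).
Proof. exact: tens_lift_pure balanced_tens_map _ _. Qed.

Lemma tens_mapD : {morph tens_map f g : x y / x + y}.
Proof. by move=> x y; exact: tens_liftD balanced_tens_map. Qed.

Lemma tens_map0 : tens_map f g 0 = 0.
Proof. exact: tens_lift_zero balanced_tens_map. Qed.

Lemma tens_map_sum I (r : seq I) (P : pred I) (F : I -> tens A B) :
  tens_map f g (\sum_(i <- r | P i) F i) = \sum_(i <- r | P i) tens_map f g (F i).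
Proof. exact: (big_morph _ tens_mapD tens_map0). Qed.

Lemma tens_map_hom : star_hom (tens_map f g).
Proof.
split=> [|x y|c|x]; first exact: tens_mapD.
- rewrite [x]tpure_sum [y]tpure_sum mulr_suml !tens_map_sum mulr_suml.
  apply: eq_bigr => p _; rewrite !mulr_sumr tens_map_sum.
  apply: eq_bigr => q _; rewrite tpureM !tens_map_pure tpureM.
  by rewrite (star_homM hf) (star_homM hg).
- rewrite [salg c](_ : _ = tpure (salg c) 1) // tens_map_pure.
  by rewrite (star_hom_salg hf) (star_hom1 hg).
- rewrite [x]tpure_sum star_sum !tens_map_sum star_sum; apply: eq_bigr => p _.
  by rewrite star_tpure !tens_map_pure star_tpure (star_hom_star hf) (star_hom_star hg).
Qed.

End TensMap.

End StarHom.

(** * Isomorphisms given by an orthogonal change of generators *)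

Section BaseChange.
Variables (C : numClosedFieldType) (N : nat).
Implicit Types M : 'M[C]_N.

Definition mxsalg (A : starAlgType C) M : 'M[A]_N := map_mx salg M.

Definition base_change (A : starAlgType C) M (u : 'M[A]_N) : 'M[A]_N :=
  mxsalg A M *m u *m mxsalg A M^T.

Definition orthogonal_mx M := M *m M^T = 1%:M.

Lemma orthogonal_mxV M : orthogonal_mx M -> M^T *m M = 1%:M.
Proof. exact: mulmx1C. Qed.

Lemma orthogonal_mx_tr M : orthogonal_mx M -> orthogonal_mx M^T.
Proof. by move=> /mulmx1C; rewrite /orthogonal_mx trmxK. Qed.

Lemma orthogonal_mxM M M' :
  orthogonal_mx M -> orthogonal_mx M' -> orthogonal_mx (M *m M').
Proof.
by move=> oM oM'; rewrite /orthogonal_mx trmx_mul mulmxA -(mulmxA M) oM' mulmx1.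
Qed.

Lemma mxsalgM (A : starAlgType C) M M' :
  mxsalg A (M *m M') = mxsalg A M *m mxsalg A M'.
Proof. exact: map_mxM. Qed.

Lemma base_change1 (A : starAlgType C) (u : 'M[A]_N) : base_change 1%:M u = u.
Proof. by rewrite /base_change trmx1 /mxsalg map_mx1 mul1mx mulmx1. Qed.

Lemma base_changeM (A : starAlgType C) M M' (u : 'M[A]_N) :
  base_change M (base_change M' u) = base_change (M *m M') u.
Proof. by rewrite /base_change trmx_mul !mxsalgM !mulmxA. Qed.

Lemma base_changeE (A : starAlgType C) M (u : 'M[A]_N) i j :
  base_change M u i j = \sum_a \sum_b salg (M i a * M j b) * u a b.
Proof.
rewrite mxE exchange_big; apply: eq_bigr => b _; rewrite mxE mulr_suml.
apply: eq_bigr => a _.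
by rewrite !mxE -salgC mulrA -rmorphM [M j b * _]mulrC.
Qed.

Lemma star_hom_base_change (A B : starAlgType C) (f : A -> B) M (u : 'M[A]_N) :
  star_hom f -> map_mx f (base_change M u) = base_change M (map_mx f u).
Proof.
move=> hf; apply/matrixP => i j; rewrite mxE !base_changeE (star_hom_sum hf).
apply: eq_bigr => a _; rewrite (star_hom_sum hf); apply: eq_bigr => b _.
by rewrite (star_homM hf) (star_hom_salg hf) mxE.
Qed.

(** The factor M^T M between the two tensor legs cancels. *)
Lemma comulmx_base_change (A B : starAlgType C) M (u : 'M[A]_N) (v : 'M[B]_N) :
  orthogonal_mx M ->
  comulmx (base_change M u) (base_change M v) = base_change M (comulmx u v).
Proof.
move=> /orthogonal_mxV oM.
(* Splitting each leg off turns comulmx into a product of matrices. *)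
have tprod (x : A) (y : B) : tpure x y = tpure x 1 * tpure 1 y.
  by rewrite tpureM mul1r mulr1.
have cE (x : 'M[A]_N) (y : 'M[B]_N) :
    comulmx x y = map_mx (fun a => tpure a 1) x *m map_mx (fun b => tpure 1 b) y.
  apply/matrixP => i j; rewrite !mxE; apply: eq_bigr => k _.
  by rewrite !mxE -tprod.
have lM (x y : 'M[A]_N) : map_mx (fun a => tpure a (1 : B)) (x *m y) =
    map_mx (fun a => tpure a 1) x *m map_mx (fun a => tpure a 1) y.
  apply/matrixP => i j; rewrite !mxE tpure_suml; apply: eq_bigr => k _.
  by rewrite !mxE tpureM mulr1.
have rM (x y : 'M[B]_N) : map_mx (fun b => tpure (1 : A) b) (x *m y) =
    map_mx (fun b => tpure 1 b) x *m map_mx (fun b => tpure 1 b) y.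
  apply/matrixP => i j; rewrite !mxE tpure_sumr; apply: eq_bigr => k _.
  by rewrite !mxE tpureM mulr1.
have lS M' : map_mx (fun a => tpure a (1 : B)) (mxsalg A M') = mxsalg _ M'.
  by apply/matrixP => i j; rewrite !mxE.
have rS M' : map_mx (fun b => tpure (1 : A) b) (mxsalg B M') = mxsalg _ M'.
  by apply/matrixP => i j; rewrite !mxE -[salg _]mulr1 -tpureZ mulr1.
rewrite !cE /base_change !lM !rM !lS !rS !mulmxA.
rewrite -(mulmxA _ (mxsalg _ M^T) (mxsalg _ M)) -mxsalgM oM.
by rewrite /mxsalg map_mx1 mulmx1.
Qed.

(** The two lifts are mutually inverse because they are so on generators, and
    both sides of the compatibility with the comultiplication are star
    homomorphisms, so that generators suffice there too. *)
Lemma presented_qgroup_iso (P Q : relations C N) (Pgen : P _ (ugen P))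
    (Pmul : comul_stable P) (Qgen : Q _ (ugen Q)) (Qmul : comul_stable Q) M :
  orthogonal_mx M ->
  (forall (A : starAlgType C) (u : 'M[A]_N), P A u -> Q A (base_change M u)) ->
  (forall (A : starAlgType C) (v : 'M[A]_N), Q A v -> P A (base_change M^T v)) ->
  qgroup_iso (presented_qgroup Pgen Pmul) (presented_qgroup Qgen Qmul).
Proof.
move=> oM PQ QP.
pose f := univ_lift (P := P) (base_change M^T (ugen Q)).
pose g := univ_lift (P := Q) (base_change M (ugen P)).
have hf : star_hom f by apply: univ_lift_hom; exact: QP.
have hg : star_hom g by apply: univ_lift_hom; exact: PQ.
have fE : map_mx f (ugen P) = base_change M^T (ugen Q).
  by apply/matrixP => i j; rewrite mxE; apply: univ_lift_gen; exact: QP.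
have gE : map_mx g (ugen Q) = base_change M (ugen P).
  by apply/matrixP => i j; rewrite mxE; apply: univ_lift_gen; exact: PQ.
pose dP := univ_lift (P := P) (comulmx (ugen P) (ugen P)).
pose dQ := univ_lift (P := Q) (comulmx (ugen Q) (ugen Q)).
have hP : star_hom dP by apply: univ_lift_hom; exact: Pmul.
have hQ : star_hom dQ by apply: univ_lift_hom; exact: Qmul.
have dPE : map_mx dP (ugen P) = comulmx (ugen P) (ugen P).
  by apply/matrixP => i j; rewrite mxE; apply: univ_lift_gen; exact: Pmul.
have dQE : map_mx dQ (ugen Q) = comulmx (ugen Q) (ugen Q).
  by apply/matrixP => i j; rewrite mxE; apply: univ_lift_gen; exact: Qmul.
have hff := tens_map_hom hf hf.
have comul : dQ \o f =1 tens_map f f \o dP.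
  apply: univ_lift_uniq (star_hom_comp hQ hf) (star_hom_comp hff hP) _ => i j.
  transitivity (map_mx dQ (map_mx f (ugen P)) i j); first by rewrite !mxE.
  transitivity (map_mx (tens_map f f) (map_mx dP (ugen P)) i j); last first.
    by rewrite !mxE.
  rewrite fE star_hom_base_change // dQE dPE -comulmx_base_change; last first.
    exact: orthogonal_mx_tr.
  rewrite -fE !mxE tens_map_sum //; apply: eq_bigr => k _.
  by rewrite tens_map_pure // !mxE.
exists f; split=> //.
  exists g.
  - apply: univ_lift_uniq (star_hom_comp hg hf) (star_hom_id _) _ => i j.
    transitivity (map_mx g (map_mx f (ugen P)) i j); first by rewrite !mxE.
    by rewrite fE star_hom_base_change // gE base_changeM orthogonal_mxV // base_change1.
  - apply: univ_lift_uniq (star_hom_comp hf hg) (star_hom_id _) _ => i j.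
    transitivity (map_mx f (map_mx g (ugen Q)) i j); first by rewrite !mxE.
    by rewrite gE star_hom_base_change // fE base_changeM oM base_change1.
Qed.
End BaseChange.

(** * Real orthogonal matrices and intertwiners *)

Section RealOrthogonal.
Variables (C : numClosedFieldType) (N : nat).

Definition real_orthogonal (A : starAlgType C) (u : 'M[A]_N) : Prop :=
  [/\ forall i j, star (u i j) = u i j, u *m u^T = 1%:M & u^T *m u = 1%:M].

Definition real_mx (M : 'M[C]_N) := forall i j, (M i j)^* = M i j.

Lemma base_change_tr (A : starAlgType C) M (u : 'M[A]_N) :
  (base_change M u)^T = base_change M u^T.
Proof.
apply/matrixP => i j; rewrite mxE !base_changeE exchange_big.
by apply: eq_bigr => b _; apply: eq_bigr => a _; rewrite mxE mulrC.
Qed.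

Lemma base_change_mul (A : starAlgType C) M (u v : 'M[A]_N) :
  orthogonal_mx M -> base_change M u *m base_change M v = base_change M (u *m v).
Proof.
move=> /orthogonal_mxV oM; rewrite /base_change !mulmxA.
rewrite -(mulmxA _ (mxsalg _ M^T) (mxsalg _ M)) -mxsalgM oM.
by rewrite /mxsalg map_mx1 mulmx1.
Qed.

Lemma base_change_id (A : starAlgType C) M :
  orthogonal_mx M -> base_change M 1%:M = 1%:M :> 'M[A]_N.
Proof. by move=> oM; rewrite /base_change mulmx1 -mxsalgM oM /mxsalg map_mx1. Qed.

Lemma real_orthogonal_base_change (A : starAlgType C) M (u : 'M[A]_N) :
  orthogonal_mx M -> real_mx M -> real_orthogonal u ->
  real_orthogonal (base_change M u).
Proof.
move=> oM rM [su uut utu]; split.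
- move=> i j; rewrite base_changeE star_sum; apply: eq_bigr => a _.
  rewrite star_sum; apply: eq_bigr => b _.
  have rMM : (M i a * M j b)^* = M i a * M j b by rewrite rmorphM /= !rM.
  by rewrite starM star_salg su -salgC rMM.
- by rewrite base_change_tr base_change_mul // uut base_change_id.
- by rewrite base_change_tr base_change_mul // utu base_change_id.
Qed.

Lemma col_orthonormal (A : starAlgType C) (u : 'M[A]_N) i j :
  u^T *m u = 1%:M -> \sum_k u k i * u k j = (i == j)%:R.
Proof.
move=> /matrixP/(_ i j); rewrite !mxE => <-.
by apply: eq_bigr => k _; rewrite mxE.
Qed.

End RealOrthogonal.

Section Intertwiners.
Variables (C : numClosedFieldType) (N : nat) (A : starAlgType C) (u : 'M[A]_N).
Local Notation mindex := (mindex N).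
Local Notation lin := (lin C N).

Definition intertwines k l (T : lin k l) : Prop := forall y x,
  \sum_(z : mindex k) salg (T y z) * tpow u z x =
  \sum_(z : mindex l) tpow u y z * salg (T z x).

Lemma sum_mindex_cat k l (F : mindex (k + l) -> A) :
  \sum_y F y = \sum_(y : mindex k) \sum_(x : mindex l) F (mcat y x).
Proof.
rewrite pair_big /=; apply: (reindex (fun p => mcat p.1 p.2)).
exists (fun y => (mleft y, mright y)) => [[y x] _|y _] /=.
  by rewrite mleft_cat mright_cat.
by rewrite mcat_lr.
Qed.

Lemma tpow_cat k l (y x : mindex (k + l)) :
  tpow u y x = tpow u (mleft y) (mleft x) * tpow u (mright y) (mright x).
Proof.
rewrite /tpow big_split_ord; congr (_ * _);
by apply: eq_bigr => i _; rewrite !ffunE.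
Qed.

Lemma intertwines_zero k l : intertwines (fun (_ : mindex l) (_ : mindex k) => 0).
Proof.
by move=> y x; rewrite !big1 // => z _; rewrite rmorph0 ?mul0r ?mulr0.
Qed.

Lemma intertwines_add k l (S T : lin k l) : intertwines S -> intertwines T ->
  intertwines (fun y x => S y x + T y x).
Proof.
move=> hS hT y x; under eq_bigr do rewrite rmorphD mulrDl.
under [RHS]eq_bigr do rewrite rmorphD mulrDr.
by rewrite !big_split hS hT.
Qed.

Lemma intertwines_scale k l c (T : lin k l) : intertwines T ->
  intertwines (fun y x => c * T y x).
Proof.
move=> hT y x; under eq_bigr do rewrite rmorphM -mulrA.
under [RHS]eq_bigr do rewrite rmorphM mulrA -(salgC c) -mulrA.
by rewrite -!mulr_sumr hT.
Qed.

Lemma intertwines_id k : intertwines (@lid C N k).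
Proof.
move=> y x; rewrite (bigD1 y) //= [X in _ + X]big1 => [|z zy]; last first.
  by rewrite /lid eq_sym (negPf zy) rmorph0 mul0r.
rewrite [RHS](bigD1 x) //= [X in _ = _ + X]big1 => [|z zx]; last first.
  by rewrite /lid (negPf zx) rmorph0 mulr0.
by rewrite /lid !eqxx rmorph1 mul1r mulr1.
Qed.

Lemma intertwines_comp k l m (T : lin l m) (S : lin k l) :
  intertwines T -> intertwines S -> intertwines (lcomp T S).
Proof.
move=> hT hS y x.
transitivity (\sum_w salg (T y w) * \sum_z salg (S w z) * tpow u z x).
  under eq_bigr do rewrite rmorph_sum mulr_suml.
  rewrite exchange_big; apply: eq_bigr => w _; rewrite mulr_sumr.
  by apply: eq_bigr => z _; rewrite rmorphM mulrA.
transitivity (\sum_w (\sum_z tpow u y z * salg (T z w)) * salg (S w x)).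
  under eq_bigr do rewrite hS mulr_sumr.
  rewrite exchange_big; apply: eq_bigr => w _; rewrite -hT mulr_suml.
  by apply: eq_bigr => z _; rewrite mulrA.
under [RHS]eq_bigr do rewrite rmorph_sum mulr_sumr.
rewrite [RHS]exchange_big; apply: eq_bigr => w _; rewrite mulr_suml.
by apply: eq_bigr => z _; rewrite rmorphM mulrA.
Qed.

Lemma intertwines_tens k1 l1 k2 l2 (S : lin k1 l1) (T : lin k2 l2) :
  intertwines S -> intertwines T -> intertwines (ltens S T).
Proof.
move=> hS hT y x; rewrite !sum_mindex_cat.
transitivity ((\sum_z salg (S (mleft y) z) * tpow u z (mleft x)) *
    (\sum_z salg (T (mright y) z) * tpow u z (mright x))).
  rewrite mulr_suml; apply: eq_bigr => z _; rewrite mulr_sumr.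
  apply: eq_bigr => w _; rewrite /ltens tpow_cat !mleft_cat !mright_cat rmorphM.
  by rewrite -!mulrA [in RHS](mulrA (tpow _ _ _)) -salgC -!mulrA.
rewrite hS hT mulr_suml; apply: eq_bigr => z _; rewrite mulr_sumr.
apply: eq_bigr => w _; rewrite /ltens tpow_cat !mleft_cat !mright_cat rmorphM.
by rewrite -!mulrA [in LHS](mulrA (salg _)) salgC -!mulrA salgC.
Qed.

End Intertwiners.

(** * Projections onto squares of basis vectors *)

Section Quartic.
Variables (C : numClosedFieldType) (N : nat).

(** The relation T (v (x) v) = (v (x) v) T for an operator T on two-tensors,
    T a b c d being its entry in row (a, b) and column (c, d). *)
Definition commutes (A : starAlgType C) (v : 'M[A]_N)
    (T : 'I_N -> 'I_N -> 'I_N -> 'I_N -> C) : Prop :=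
  forall a b c d,
    \sum_x \sum_y salg (T a b x y) * (v x c * v y d) =
    \sum_x \sum_y v a x * v b y * salg (T x y c d).

(** The entries of the projection onto the span of the phi_i (x) phi_i, when
    the rows phi_i of phi are orthonormal and real. *)
Definition quartic (phi : 'I_N -> 'I_N -> C) a b c d : C :=
  \sum_i phi i a * phi i b * (phi i c * phi i d).

(** The relations which define the free hyperoctahedral quantum group inside
    the free orthogonal one. *)
Definition hyperoctahedral (A : starAlgType C) (v : 'M[A]_N) : Prop :=
  (forall i p q, p != q -> v i p * v i q = 0) /\
  (forall i p q, p != q -> v p i * v q i = 0).

Lemma eq_commutes (A : starAlgType C) (v : 'M[A]_N) T T' :
  (forall a b c d, T a b c d = T' a b c d) -> commutes v T -> commutes v T'.
Proof.
move=> TT' h a b c d.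
under eq_bigr do under eq_bigr do rewrite -TT'.
under [RHS]eq_bigr do under eq_bigr do rewrite -TT'.
exact: h.
Qed.

Lemma commutes_linear (A : starAlgType C) (v : 'M[A]_N) T T' x x' :
  commutes v T -> commutes v T' ->
  commutes v (fun a b c d => x * T a b c d + x' * T' a b c d).
Proof.
move=> h h' a b c d.
transitivity (salg x * (\sum_z \sum_w salg (T a b z w) * (v z c * v w d)) +
              salg x' * (\sum_z \sum_w salg (T' a b z w) * (v z c * v w d))).
  rewrite !mulr_sumr -big_split; apply: eq_bigr => z _.
  rewrite !mulr_sumr -big_split; apply: eq_bigr => w _.
  by rewrite rmorphD !rmorphM mulrDl !mulrA.
rewrite h h' !mulr_sumr -big_split; apply: eq_bigr => z _.
rewrite !mulr_sumr -big_split; apply: eq_bigr => w _.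
rewrite rmorphD !rmorphM mulrDr !(mulrA (v a z * v b w)).
by rewrite -(salgC x) -(salgC x') !mulrA.
Qed.

Lemma commutes_tr (A : starAlgType C) (v : 'M[A]_N) T :
  (forall a b c d, T a b c d = T c d a b) -> commutes v T -> commutes v^T T.
Proof.
move=> Tsym h a b c d; have /esym e := h c d a b.
transitivity (\sum_x \sum_y v c x * v d y * salg (T x y a b)).
  by apply: eq_bigr => x _; apply: eq_bigr => y _; rewrite !mxE Tsym salgC.
rewrite e; apply: eq_bigr => x _; apply: eq_bigr => y _.
by rewrite !mxE Tsym salgC.
Qed.

Lemma quartic_sym phi a b c d : quartic phi a b c d = quartic phi c d a b.
Proof. by apply: eq_bigr => i _; rewrite mulrC. Qed.

Section Monomial.
Variables (A : starAlgType C) (phi : 'M[C]_N).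
Hypothesis ophi : orthogonal_mx phi.

Lemma onb_row i j : \sum_a phi i a * phi j a = (i == j)%:R.
Proof.
have /matrixP/(_ i j) := ophi; rewrite !mxE => <-.
by apply: eq_bigr => a _; rewrite mxE.
Qed.

Lemma salgAC (x : A) c (y : A) : x * (salg c * y) = salg c * (x * y).
Proof. by rewrite mulrA -salgC mulrA. Qed.

Lemma salgACA c d (x y : A) : salg c * x * (salg d * y) = salg (c * d) * (x * y).
Proof. by rewrite -mulrA salgAC mulrA rmorphM. Qed.

Lemma mulACsalg c d (x y : A) : x * salg c * (y * salg d) = x * y * salg (c * d).
Proof. by rewrite -!salgC salgACA. Qed.

Let Y (v : 'M[A]_N) i c : A := \sum_a salg (phi i a) * v a c.
Let Z (v : 'M[A]_N) a p : A := \sum_x v a x * salg (phi p x).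

Lemma quartic_mul (v : 'M[A]_N) a b c d :
  \sum_x \sum_y salg (quartic phi a b x y) * (v x c * v y d) =
  \sum_i salg (phi i a * phi i b) * (Y v i c * Y v i d).
Proof.
transitivity (\sum_x \sum_y \sum_i salg (phi i a * phi i b) *
    ((salg (phi i x) * v x c) * (salg (phi i y) * v y d))).
  apply: eq_bigr => x _; apply: eq_bigr => y _.
  rewrite rmorph_sum mulr_suml; apply: eq_bigr => i _.
  by rewrite salgACA [RHS]mulrA -rmorphM.
under eq_bigr do rewrite exchange_big.
rewrite exchange_big; apply: eq_bigr => i _.
rewrite mulr_suml mulr_sumr; apply: eq_bigr => x _.
by rewrite !mulr_sumr.
Qed.

Lemma mul_quartic (v : 'M[A]_N) a b c d :
  \sum_x \sum_y v a x * v b y * salg (quartic phi x y c d) =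
  \sum_p Z v a p * Z v b p * salg (phi p c * phi p d).
Proof.
transitivity (\sum_x \sum_y \sum_i
    (v a x * salg (phi i x)) * (v b y * salg (phi i y)) *
    salg (phi i c * phi i d)).
  apply: eq_bigr => x _; apply: eq_bigr => y _.
  rewrite rmorph_sum mulr_sumr; apply: eq_bigr => i _.
  by rewrite mulACsalg -[RHS]mulrA -rmorphM.
under eq_bigr do rewrite exchange_big.
rewrite exchange_big; apply: eq_bigr => i _.
rewrite !mulr_suml; apply: eq_bigr => x _.
by rewrite mulr_sumr mulr_suml.
Qed.

Lemma base_change_rowE (v : 'M[A]_N) i p :
  base_change phi v i p = \sum_c Y v i c * salg (phi p c).
Proof.
rewrite mxE; apply: eq_bigr => c _; rewrite !mxE; congr (_ * _).
by apply: eq_bigr => a _; rewrite mxE.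
Qed.

Lemma mul_base_change (v : 'M[A]_N) i c :
  Y v i c = \sum_p base_change phi v i p * salg (phi p c).
Proof.
have e : mxsalg A phi *m v = base_change phi v *m mxsalg A phi.
  rewrite /base_change -!mulmxA -mxsalgM orthogonal_mxV //.
  by rewrite /mxsalg map_mx1 mulmx1.
have /matrixP/(_ i c) := e; rewrite !mxE => {}e.
transitivity (\sum_j mxsalg A phi i j * v j c).
  by apply: eq_bigr => a _; rewrite mxE.
by rewrite e; apply: eq_bigr => p _; rewrite [mxsalg _ _ _ _]mxE.
Qed.

(** Contracting the commutation relation with phi_j (x) phi_j on the left and
    with phi_p (x) phi_q on the right leaves the product of two entries of row
    j on one side and, for distinct p and q, zero on the other. *)
Lemma commutes_quartic_row (v : 'M[A]_N) : commutes v (quartic phi) ->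
  forall j p q, p != q -> base_change phi v j p * base_change phi v j q = 0.
Proof.
move=> h j p q pq.
(* Orthonormality isolates the term i = j on the left of the relation. *)
have YY c d : Y v j c * Y v j d = \sum_a \sum_b salg (phi j a * phi j b) *
    \sum_r Z v a r * Z v b r * salg (phi r c * phi r d).
  transitivity (\sum_a \sum_b salg (phi j a * phi j b) *
      \sum_i salg (phi i a * phi i b) * (Y v i c * Y v i d)).
    transitivity (\sum_i (\sum_a salg (phi j a * phi i a)) *
        (\sum_b salg (phi j b * phi i b)) * (Y v i c * Y v i d)).
      rewrite (bigD1 j) //= -!rmorph_sum !onb_row eqxx rmorph1 !mul1r big1 ?addr0 //.
      by move=> i ij; rewrite -!rmorph_sum onb_row eq_sym (negPf ij) rmorph0 !mul0r.
    under [RHS]eq_bigr do under eq_bigr do rewrite mulr_sumr.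
    under [RHS]eq_bigr do rewrite exchange_big.
    rewrite [RHS]exchange_big; apply: eq_bigr => i _.
    rewrite -mulrA mulr_suml; apply: eq_bigr => a _.
    rewrite mulr_suml mulr_sumr; apply: eq_bigr => b _.
    by rewrite !mulrA -!rmorphM; congr (salg _ * _ * _); ring.
  apply: eq_bigr => a _; apply: eq_bigr => b _; congr (_ * _).
  by rewrite -quartic_mul -mul_quartic.
rewrite !base_change_rowE.
transitivity (\sum_c \sum_d (Y v j c * Y v j d) * salg (phi p c * phi q d)).
  rewrite mulr_suml; apply: eq_bigr => c _; rewrite mulr_sumr.
  by apply: eq_bigr => d _; rewrite mulACsalg.
transitivity (\sum_a \sum_b salg (phi j a * phi j b) *
    \sum_r Z v a r * Z v b r *
      salg (\sum_c \sum_d (phi r c * phi p c) * (phi r d * phi q d))).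
  under eq_bigr do under eq_bigr do
    (rewrite YY mulr_suml; under eq_bigr do rewrite mulr_suml).
  under eq_bigr do rewrite exchange_big.
  rewrite exchange_big; apply: eq_bigr => a _.
  under eq_bigr do rewrite exchange_big.
  rewrite exchange_big; apply: eq_bigr => b _.
  under eq_bigr do under eq_bigr do rewrite -mulrA mulr_suml.
  under eq_bigr do rewrite -mulr_sumr exchange_big /=.
  rewrite -mulr_sumr exchange_big /=; congr (_ * _); apply: eq_bigr => r _.
  move: (Z v a r * Z v b r) => zz; rewrite rmorph_sum mulr_sumr; apply: eq_bigr => c _.
  rewrite rmorph_sum mulr_sumr; apply: eq_bigr => d _.
  by rewrite -mulrA -rmorphM; congr (_ * salg _); ring.
rewrite big1 // => a _; rewrite big1 // => b _; rewrite big1 ?mulr0 // => r _.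
under eq_bigr do rewrite -mulr_sumr onb_row.
rewrite -mulr_suml onb_row.
have [->|_] := eqVneq r p; first by rewrite (negPf pq) mulr0 rmorph0 mulr0.
by rewrite mul0r rmorph0 mulr0.
Qed.

(** Columns are handled by transposition.  Conversely, the two vanishing rules
    reduce both sides to the same sum of squares of entries. *)
Lemma commutes_quartic (v : 'M[A]_N) :
  commutes v (quartic phi) <-> hyperoctahedral (base_change phi v).
Proof.
split=> [h|[hr hc] a b c d].
  split=> i p q pq; first exact: commutes_quartic_row.
  have := commutes_quartic_row (commutes_tr (@quartic_sym phi) h) i pq.
  by rewrite -base_change_tr !mxE.
have Zt e p : Z v e p = \sum_i base_change phi v i p * salg (phi i e).
  transitivity (Y v^T p e).
    by apply: eq_bigr => x _; rewrite mxE salgC.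
  by rewrite mul_base_change -base_change_tr; apply: eq_bigr => x _; rewrite mxE.
pose X := base_change phi v.
(* Only squares of entries of X survive, on either side. *)
transitivity (\sum_i \sum_p salg (phi i a * phi i b) * (X i p * X i p) *
    salg (phi p c * phi p d)).
  rewrite quartic_mul; apply: eq_bigr => i _.
  rewrite !mul_base_change mulr_suml mulr_sumr.
  apply: eq_bigr => p _; rewrite -[RHS]mulrA; congr (_ * _).
  rewrite mulr_sumr (bigD1 p) //= big1 ?addr0 ?mulACsalg // => q qp.
  by rewrite mulACsalg hr ?mul0r // eq_sym.
rewrite exchange_big /= mul_quartic; apply: eq_bigr => p _.
rewrite -mulr_suml; congr (_ * _).
rewrite !Zt mulr_suml; apply: eq_bigr => i _.
rewrite mulr_sumr (bigD1 i) //= big1 ?addr0 => [|j ji].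
  by rewrite mulACsalg salgC.
by rewrite mulACsalg hc ?mul0r // eq_sym.
Qed.

End Monomial.
End Quartic.

(** * Orthonormal bases of C^4 with entries of modulus 1/2 *)

Section Flat.
Variable C : numClosedFieldType.

(** The last term corrects the quadruples with four equal indices, which the
    others count three times, so that all values are 0 or 1. *)
Definition pairing (a b c d : 'I_4) : C :=
  (a == b)%:R * (c == d)%:R + (a == c)%:R * (b == d)%:R
  + (a == d)%:R * (b == c)%:R - 2 * ((a == b)%:R * (a == c)%:R * (a == d)%:R).

Definition distinct (a b c d : 'I_4) : C := (uniq [:: a; b; c; d])%:R.

Definition flat (phi : 'M[C]_4) := forall i j, phi i j * phi i j = 4^-1.

Lemma prod_uniq4 (F : 'I_4 -> C) a b c d :
  uniq [:: a; b; c; d] -> \prod_r F r = F a * F b * (F c * F d).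
Proof.
move=> u4; transitivity (\prod_(r <- [:: a; b; c; d]) F r); last first.
  by rewrite !big_cons big_nil mulr1 !mulrA.
apply: perm_big; apply: uniq_perm => //; first exact: index_enum_uniq.
move=> r; rewrite mem_index_enum; apply/esym.
have /subset_cardP : #|[:: a; b; c; d]| = #|'I_4|.
  by rewrite card_ord (card_uniqP u4).
by move=> /(_ (subset_predT _)) /(_ r) ->.
Qed.

(** If two of the indices agree, the squares 1/4 factor out and what remains is
    an inner product of two columns.  If none do, each summand is the product
    of a whole row of phi. *)
Lemma quartic_flat (phi : 'M[C]_4) a b c d :
  orthogonal_mx phi -> flat phi ->
  quartic phi a b c d =
  4^-1 * pairing a b c d + (\sum_i \prod_r phi i r) * distinct a b c d.
Proof.
move=> /orthogonal_mx_tr ophi fphi.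
have two x y : \sum_i 4^-1 * (phi i x * phi i y) = 4^-1 * (x == y)%:R.
  rewrite -mulr_sumr -(onb_row ophi); congr (_ * _); apply: eq_bigr => i _.
  by rewrite !mxE.
rewrite /pairing /distinct /= !inE !negb_or.
have [<-{b}|ab] := eqVneq a b.
  rewrite mulr0 addr0.
  transitivity (\sum_i 4^-1 * (phi i c * phi i d)).
    by apply: eq_bigr => i _; rewrite fphi.
  by rewrite two /=; ring.
have [<-{c}|ac] := eqVneq a c.
  transitivity (\sum_i 4^-1 * (phi i b * phi i d)).
    by apply: eq_bigr => i _; rewrite -(fphi i a); ring.
  by rewrite two ?(eq_sym b a) ?(negPf ab) /=; ring.
have [<-{d}|ad] := eqVneq a d.
  transitivity (\sum_i 4^-1 * (phi i b * phi i c)).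
    by apply: eq_bigr => i _; rewrite -(fphi i a); ring.
  by rewrite two ?(eq_sym b a) ?(negPf ab) /=; ring.
have [<-{c ac}|bc] := eqVneq b c.
  transitivity (\sum_i 4^-1 * (phi i a * phi i d)).
    by apply: eq_bigr => i _; rewrite -(fphi i b); ring.
  by rewrite two ?(eq_sym b a) ?(negPf ab) ?(negPf ad) /=; ring.
have [<-{d ad}|bd] := eqVneq b d.
  transitivity (\sum_i 4^-1 * (phi i a * phi i c)).
    by apply: eq_bigr => i _; rewrite -(fphi i b); ring.
  by rewrite two ?(negPf ab) ?(negPf ac) ?(eq_sym c b) ?(negPf bc) /=; ring.
have [<-{d ad bd}|cd] := eqVneq c d.
  transitivity (\sum_i 4^-1 * (phi i a * phi i b)).
    by apply: eq_bigr => i _; rewrite -(fphi i c); ring.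
  by rewrite two ?(negPf ab) ?(negPf ac) ?(negPf bc) /=; ring.
transitivity (\sum_i \prod_r phi i r); last by rewrite /=; ring.
apply: eq_bigr => i _.
have u4 : uniq [:: a; b; c; d] by rewrite /= !inE !negb_or ab ac ad bc bd cd.
by rewrite (prod_uniq4 _ u4).
Qed.

Lemma flat_prod_sq (phi : 'M[C]_4) i :
  flat phi -> (\prod_r phi i r) * (\prod_r phi i r) = 4^-1 ^+ 4.
Proof.
move=> fphi; rewrite -big_split /=; under eq_bigr do rewrite fphi.
by rewrite prodr_const card_ord.
Qed.

Lemma flat_prod_neq0 (phi : 'M[C]_4) i : flat phi -> \prod_r phi i r != 0.
Proof.
move=> fphi; apply/eqP => p0; have /eqP := flat_prod_sq i fphi.
by rewrite p0 mul0r eq_sym expf_eq0 /= invr_eq0 pnatr_eq0.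
Qed.

(** The entrywise products z_r of two distinct rows have equal squares and sum
    to zero, so that z_0 z_1 = z_2 z_3: an even number of them is negative. *)
Lemma flat_prod (phi : 'M[C]_4) i j :
  orthogonal_mx phi -> flat phi -> \prod_r phi i r = \prod_r phi j r.
Proof.
move=> ophi fphi; have [->//|ij] := eqVneq i j.
apply: (mulIf (flat_prod_neq0 j fphi)); rewrite flat_prod_sq // -big_split /=.
pose z r := phi i r * phi j r.
have zz r : z r * z r = 4^-1 * 4^-1 by rewrite /z mulrACA !fphi.
have : \sum_r z r = 0 by rewrite (onb_row ophi) (negPf ij).
rewrite -/(\prod_r z r) !big_ord_recl !big_ord0.
set i1 := lift ord0 _; set i2 := lift ord0 _; set i3 := lift ord0 _.
move: (zz ord0) (zz i1) (zz i2) (zz i3).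
move: (z ord0) (z i1) (z i2) (z i3) => p q r s pp qq rr ss sum0.
have pqrs : p * q = r * s.
  have e : p + q = - (r + s) by apply/eqP; rewrite -addr_eq0 -sum0; apply/eqP; ring.
  apply: (@mulfI _ (2 : C)); first by rewrite pnatr_eq0.
  transitivity ((p + q) ^+ 2 - p * p - q * q); first ring.
  by rewrite e sqrrN pp qq -[in X in _ - X - _]rr -ss; ring.
transitivity ((p * q) * (r * s)); first ring.
by rewrite -pqrs mulrACA pp qq; ring.
Qed.

End Flat.

(** * A third unbiased basis *)

Section Reflection.
Variable C : numClosedFieldType.
Variable W : 'M[C]_4.
Hypotheses (oW : orthogonal_mx W) (fW : flat W).

Definition reflection : 'M[C]_4 := diag_mx (\row_i (if i == ord0 then -1 else 1)).

Lemma reflection_tr : reflection^T = reflection.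
Proof. exact: tr_diag_mx. Qed.

Lemma reflection_orthogonal : orthogonal_mx reflection.
Proof.
rewrite /orthogonal_mx reflection_tr mulmx_diag; apply/matrixP => i j.
by rewrite !mxE; case: (i == ord0); rewrite ?mulrNN mulr1.
Qed.

(** The rows of mub form a basis unbiased both to the standard basis and to the
    rows of W: its products with the former are its entries, and its products
    with the latter are given by the Householder reflection of mub_trE. *)
Definition mub : 'M[C]_4 := W *m reflection.

Lemma mub_orthogonal : orthogonal_mx mub.
Proof. exact: orthogonal_mxM oW reflection_orthogonal. Qed.

Lemma mubE i j : mub i j = if j == ord0 then - W i j else W i j.
Proof.
by rewrite /mub /reflection mul_mx_diag !mxE; case: ifP; rewrite ?mulrN1 ?mulr1.
Qed.

Lemma mub_trE i j : (W *m mub^T) i j = (i == j)%:R - 2 * (W i ord0 * W j ord0).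
Proof.
rewrite -(onb_row oW) mxE (bigD1 ord0) //= [in RHS](bigD1 ord0) //=.
rewrite mxE mubE eqxx (eq_bigr (fun a => W i a * W j a)) => [|a a0]; last first.
  by rewrite mxE mubE (negPf a0).
ring.
Qed.

Lemma flat_mub : flat mub^T.
Proof. by move=> i j; rewrite mxE mubE; case: ifP; rewrite ?mulrNN fW. Qed.

Lemma flat_mub_tr : flat (W *m mub^T).
Proof.
move=> i j; rewrite mub_trE.
transitivity ((i == j)%:R * (1 - 4 * (W i ord0 * W j ord0))
   + 4 * ((W i ord0 * W i ord0) * (W j ord0 * W j ord0))).
  by case: (i == j) => /=; ring.
by rewrite !fW; have [->|_] := eqVneq i j; rewrite ?fW /=; field.
Qed.

Let p := \prod_r W r ord0.

Lemma prod_col i : \prod_r W r i = p.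
Proof.
have fWT : flat W^T by move=> a b; rewrite mxE fW.
have := flat_prod i ord0 (orthogonal_mx_tr oW) fWT.
by under eq_bigr do rewrite mxE; under [in RHS]eq_bigr do rewrite mxE.
Qed.

Lemma sum_prod_mub : \sum_i \prod_r mub^T i r = 4 * p.
Proof.
rewrite (eq_bigr (fun=> p)) => [|i _]; last first.
  under eq_bigr do rewrite mxE mubE; case: (i == ord0); last exact: prod_col.
  by rewrite prodrN card_ord prod_col -signr_odd mul1r.
by rewrite sumr_const card_ord mulr_natl.
Qed.

(** By mub_trE, row i of W mub^T is the multiple of the column W r 0 by
    -2 W i 0 except in entry i, where the sign is the opposite one.  As
    (2 W i 0)^4 = 1, the product of the row is - p. *)
Lemma sum_prod_mub_tr : \sum_i \prod_r (W *m mub^T) i r = - (4 * p).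
Proof.
rewrite (eq_bigr (fun=> - p)) => [|i _]; last first.
  have fWi : W i ord0 * W i ord0 = 4^-1 by exact: fW.
  have e : (W *m mub^T) i i = (- (2 * W i ord0)) * W i ord0 * -1.
    transitivity (2 * (W i ord0 * W i ord0)); last by ring.
    by rewrite mub_trE eqxx fWi /=; field.
  rewrite (bigD1 i) //= e (eq_bigr (fun r => (- (2 * W i ord0)) * W r ord0)).
    rewrite mulrAC.
    rewrite -(bigD1 (P := xpredT) (F := fun r => - (2 * W i ord0) * W r ord0) i) //=.
    rewrite big_split prodr_const card_ord /= -/p.
    have -> : (- (2 * W i ord0)) ^+ 4 =
        16 * ((W i ord0 * W i ord0) * (W i ord0 * W i ord0)) by ring.
    by rewrite fWi; field.
  by move=> r ri; rewrite mub_trE eq_sym (negPf ri) /=; ring.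
by rewrite sumr_const card_ord -mulr_natl; ring.
Qed.

Lemma orthogonal_mub_tr : orthogonal_mx (W *m mub^T).
Proof. exact: orthogonal_mxM oW (orthogonal_mx_tr mub_orthogonal). Qed.

(** The two projections are pairing / 4 + 4 p distinct and
    pairing / 4 - 4 p distinct with p nonzero, so they span the same plane as
    pairing and distinct. *)
Lemma commutes_mub (A : starAlgType C) (v : 'M[A]_4) :
  commutes v (quartic mub^T) /\ commutes v (quartic (W *m mub^T)) <->
  commutes v (@pairing C) /\ commutes v (@distinct C).
Proof.
have p0 : p != 0.
  have := flat_prod_neq0 (phi := W^T) ord0.
  under eq_bigr do rewrite mxE; apply.
  by move=> i j; rewrite mxE fW.
have qE a b c d : quartic mub^T a b c d =
    4^-1 * pairing C a b c d + 4 * p * distinct C a b c d.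
  rewrite quartic_flat ?sum_prod_mub //; first exact: orthogonal_mx_tr mub_orthogonal.
  exact: flat_mub.
have qE' a b c d : quartic (W *m mub^T) a b c d =
    4^-1 * pairing C a b c d + - (4 * p) * distinct C a b c d.
  rewrite quartic_flat ?sum_prod_mub_tr //; first exact: orthogonal_mub_tr.
  exact: flat_mub_tr.
split=> [[h h']|[h h']]; split.
- apply: eq_commutes (commutes_linear 2 2 h h') => a b c d.
  by rewrite qE qE'; field.
- apply: eq_commutes (commutes_linear (8 * p)^-1 (- (8 * p)^-1) h h') => a b c d.
  by rewrite qE qE'; field.
- by apply: eq_commutes (commutes_linear 4^-1 (4 * p) h h') => a b c d; rewrite qE.
- by apply: eq_commutes (commutes_linear 4^-1 (- (4 * p)) h h') => a b c d; rewrite qE'.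
Qed.

End Reflection.

(** * The relations of the anticommutative special orthogonal group *)

Section Anticommutation.
Variables (C : numClosedFieldType) (A : starAlgType C).
Implicit Type v : 'M[A]_4.

Lemma sum_delta n (a : 'I_n) (F : 'I_n -> A) :
  \sum_x salg (a == x)%:R * F x = F a.
Proof.
rewrite (bigD1 a) //= big1 => [|x xa]; first by rewrite eqxx rmorph1 mul1r addr0.
by rewrite eq_sym (negPf xa) rmorph0 mul0r.
Qed.

Lemma pairing_sym a b c d : pairing C a b c d = pairing C c d a b.
Proof.
have e : (a == b)%:R * (a == c)%:R * (a == d)%:R =
    (c == d)%:R * (c == a)%:R * (c == b)%:R :> C.
  rewrite -!natrM !mulnb; congr (nat_of_bool _)%:R.
  by apply/idP/idP => /andP[/andP[/eqP <- /eqP <-] /eqP <-]; rewrite !eqxx.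
by rewrite /pairing e (eq_sym a c) (eq_sym d b) (eq_sym c b) (eq_sym d a); ring.
Qed.

Lemma pairing_mul v a b c d : real_orthogonal v ->
  \sum_x \sum_y salg (pairing C a b x y) * (v x c * v y d) =
  salg (a == b)%:R * (c == d)%:R + v a c * v b d + v b c * v a d
  - (salg (a == b)%:R * (v a c * v a d)) *+ 2.
Proof.
move=> hv.
transitivity (\sum_x (salg (a == b)%:R * (v x c * v x d)
    + salg (a == x)%:R * (v x c * v b d) + salg (b == x)%:R * (v x c * v a d)
    - salg (a == x)%:R * (salg (a == b)%:R * (v x c * v a d)) *+ 2)).
  apply: eq_bigr => x _.
  rewrite -(sum_delta x (fun y => salg (a == b)%:R * (v x c * v y d))).
  rewrite -(sum_delta b (fun y => salg (a == x)%:R * (v x c * v y d))).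
  rewrite -(sum_delta a (fun y => salg (b == x)%:R * (v x c * v y d))).
  rewrite -(sum_delta a (fun y =>
    salg (a == x)%:R * (salg (a == b)%:R * (v x c * v y d)))).
  rewrite -sumrMnl -sumrN -!big_split /=; apply: eq_bigr => y _.
  rewrite !mulrA -!rmorphM -!mulrA -mulrnAl -rmorphMn -mulNr -rmorphN.
  rewrite -!mulrDl -!rmorphD.
  by congr (salg _ * _); rewrite /pairing -mulr_natr; ring.
rewrite sumrB sumrMnl !big_split /= -mulr_sumr col_orthonormal //; last by case: hv.
by rewrite !sum_delta.
Qed.

Lemma mul_pairing v a b c d : real_orthogonal v ->
  \sum_x \sum_y v a x * v b y * salg (pairing C x y c d) =
  salg (a == b)%:R * (c == d)%:R + v a c * v b d + v a d * v b c
  - (salg (c == d)%:R * (v a c * v b c)) *+ 2.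
Proof.
move=> hv; have hvt : real_orthogonal v^T.
  by have [sv vvt vtv] := hv; split=> [i j||]; rewrite ?mxE ?trmxK.
transitivity (\sum_x \sum_y salg (pairing C c d x y) * (v^T x a * v^T y b)).
  apply: eq_bigr => x _; apply: eq_bigr => y _.
  by rewrite !mxE pairing_sym salgC.
rewrite (pairing_mul _ _ _ _ hvt) !mxE; congr (_ + _ + _ - _).
by rewrite -!(rmorph_nat salg) salgC.
Qed.

(** The operator pairing is cup-cap plus the identity plus the flip with sign
    changed on the e_a (x) e_a.  Orthogonality takes care of cup-cap, and
    commuting with the signed flip spells out as the three rules. *)
Lemma commutes_pairing v : real_orthogonal v ->
  commutes v (@pairing C) <->
  [/\ forall i k l, k != l -> v i k * v i l = - (v i l * v i k),
      forall i k l, k != l -> v k i * v l i = - (v l i * v k i)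
    & forall i j k l, i != j -> k != l -> v i k * v j l = v j l * v i k].
Proof.
move=> hv.
have key a b c d :
    (\sum_x \sum_y salg (pairing C a b x y) * (v x c * v y d) =
     \sum_x \sum_y v a x * v b y * salg (pairing C x y c d)) <->
    v b c * v a d - (salg (a == b)%:R * (v a c * v a d)) *+ 2 =
    v a d * v b c - (salg (c == d)%:R * (v a c * v b c)) *+ 2.
  rewrite pairing_mul // mul_pairing // -!(addrA (_ + _ * _)).
  by split=> [/addrI|->].
have sub2 (x : A) : x - x *+ 2 = - x by rewrite mulr2n opprD addNKr.
split=> [h|[hr hc hC] a b c d].
  split=> [i k l kl|i k l kl|i j k l ij kl].
  - have /key := h i i k l.
    rewrite eqxx (negPf kl) rmorph1 rmorph0 mul1r mul0r mul0rn subr0 sub2.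
    by move=> <-; rewrite opprK.
  - have /key := h l k i i.
    rewrite eqxx [l == k]eq_sym (negPf kl) rmorph1 rmorph0 mul1r mul0r mul0rn subr0 sub2.
    by move=> ->.
  - have /key := h j i k l.
    by rewrite [j == i]eq_sym (negPf ij) (negPf kl) rmorph0 !mul0r !mul0rn !subr0.
apply/key; have [<-|ab] := eqVneq a b; have [<-|cd] := eqVneq c d.
- by [].
- by rewrite rmorph1 rmorph0 mul1r mul0r mul0rn subr0 sub2 (hr _ _ _ cd) opprK.
- by rewrite rmorph1 rmorph0 mul1r mul0r mul0rn subr0 sub2 (hc _ _ _ ab) opprK.
- by rewrite rmorph0 !mul0r !mul0rn !subr0 hC // eq_sym.
Qed.

End Anticommutation.

Section Determinant.
Variables (C : numClosedFieldType) (A : starAlgType C).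
Implicit Type v : 'M[A]_4.

Definition mindex4 (a b c d : 'I_4) : {ffun 'I_4 -> 'I_4} :=
  [ffun i : 'I_4 => nth a [:: a; b; c; d] i].

Lemma sum_mindex4 (F : {ffun 'I_4 -> 'I_4} -> A) :
  \sum_f F f = \sum_a \sum_b \sum_c \sum_d F (mindex4 a b c d).
Proof.
rewrite !pair_bigA /=.
pose i k : 'I_4 := inord k.
rewrite (reindex (fun q => mindex4 q.1.1.1 q.1.1.2 q.1.2 q.2)) //.
exists (fun f : {ffun 'I_4 -> 'I_4} =>
    (f (i 0%N), f (i 1%N), f (i 2%N), f (i 3%N))) => [[[[a b] c] d] _|f _] /=.
  by rewrite !ffunE !inordK.
apply/ffunP => -[[|[|[|[|//]]]] k4]; rewrite ffunE /=; congr (f _); apply: val_inj;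
by rewrite /= inordK.
Qed.

Lemma injectiveb_mindex4 a b c d :
  injectiveb (mindex4 a b c d) = uniq [:: a; b; c; d].
Proof.
rewrite /injectiveb /dinjectiveb; congr (uniq _).
by rewrite !enum_ordSl enum_ord0 /= !ffunE.
Qed.

Lemma sum_perm4 v (k : 'I_4 -> 'I_4) :
  \sum_(s : 'S_4) \prod_(i < 4) v (k i) (s i) =
  \sum_(f : {ffun 'I_4 -> 'I_4}) (\prod_i v (k i) (f i)) * salg (injectiveb f)%:R.
Proof.
rewrite [RHS](bigID (fun f : {ffun 'I_4 -> 'I_4} => injectiveb f)) /=.
rewrite [X in _ = _ + X]big1 ?addr0; last first.
  by move=> f /negPf ->; rewrite rmorph0 mulr0.
rewrite [RHS](reindex_onto (@pval _) (insubd (1%g : 'S_4))) /=; last first.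
  by move=> f finj; rewrite insubdK.
rewrite [RHS](eq_bigl xpredT) /=; last first.
  by move=> s; rewrite (valP s) /=; apply/eqP; exact: valKd.
apply: eq_bigr => s _; rewrite (valP s) rmorph1 mulr1.
by apply: eq_bigr => i _; rewrite pvalE.
Qed.

Lemma sum_perm4E v a b p q :
  \sum_(s : 'S_4) \prod_(i < 4) v (mindex4 a b p q i) (s i) =
  \sum_z \sum_w (\sum_x \sum_y v a x * v b y * salg (distinct C x y z w)) *
    (v p z * v q w).
Proof.
rewrite sum_perm4 sum_mindex4.
transitivity (\sum_x \sum_y \sum_z \sum_w
    v a x * v b y * salg (distinct C x y z w) * (v p z * v q w)).
  apply: eq_bigr => x _; apply: eq_bigr => y _.
  apply: eq_bigr => z _; apply: eq_bigr => w _.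
  rewrite injectiveb_mindex4 !big_ord_recl big_ord0 !ffunE /= mulr1.
  by rewrite -[LHS]salgC -[v a x * v b y * salg _]salgC !mulrA.
under eq_bigr do rewrite exchange_big /=; rewrite exchange_big /=; apply: eq_bigr => z _.
under eq_bigr do rewrite exchange_big /=; rewrite exchange_big /=; apply: eq_bigr => w _.
by rewrite mulr_suml; apply: eq_bigr => x _; rewrite mulr_suml.
Qed.

(** Two legs v (x) v of an operator are cancelled by contraction with their
    transposes; cancelling the inner leg first avoids any commutation. *)
Lemma contract2 v (K : 'I_4 -> 'I_4 -> A) c d : v^T *m v = 1%:M ->
  \sum_p \sum_q (\sum_z \sum_w K z w * (v p z * v q w)) * (v q d * v p c) = K c d.
Proof.
move=> vtv; have col i j := col_orthonormal i j vtv.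
transitivity (\sum_z \sum_w K z w * \sum_p v p z * (\sum_q v q w * v q d) * v p c).
  under eq_bigr do under eq_bigr do rewrite mulr_suml.
  under eq_bigr do rewrite exchange_big.
  rewrite exchange_big; apply: eq_bigr => z _.
  under eq_bigr do under eq_bigr do rewrite mulr_suml.
  under eq_bigr do rewrite exchange_big.
  rewrite exchange_big; apply: eq_bigr => w _.
  rewrite mulr_sumr; apply: eq_bigr => p _.
  rewrite mulr_sumr mulr_suml mulr_sumr; apply: eq_bigr => q _.
  by rewrite !mulrA.
rewrite (bigD1 c) //= [X in _ + X]big1 ?addr0 => [|z zc]; last first.
  rewrite big1 // => w _; rewrite col; case: (w == d); last first.
    by rewrite big1 ?mulr0 // => p _; rewrite mulr0 mul0r.
  by under eq_bigr do rewrite mulr1; rewrite col (negPf zc) mulr0.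
rewrite (bigD1 d) //= [X in _ + X]big1 ?addr0 => [|w wd].
  by rewrite col eqxx; under eq_bigr do rewrite mulr1; rewrite col eqxx mulr1.
rewrite col (negPf wd) big1 ?mulr0 // => p _.
by rewrite mulr0 mul0r.
Qed.

Lemma distinct_swap a b c d : distinct C a b c d = distinct C a b d c.
Proof.
congr (nat_of_bool _)%:R; apply: perm_uniq.
by rewrite !perm_cons (perm_catC [:: c] [:: d]).
Qed.

(** The twisted determinants over all choices of rows are the entries of the
    four-tensor distinct moved by four copies of v.  Bending two of its legs
    turns invariance of this tensor into commutation with the operator
    distinct, and orthogonality allows one to bend them back. *)
Lemma commutes_distinct v : real_orthogonal v ->
  commutes v (@distinct C) <->
  (forall a b c d, \sum_(s : 'S_4) \prod_(i < 4) v (mindex4 a b c d i) (s i) =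
     salg (distinct C a b c d)).
Proof.
move=> [_ vvt vtv]; split=> h a b c d.
- rewrite sum_perm4E.
  transitivity (\sum_w \sum_z (\sum_x \sum_y salg (distinct C a b x y) *
      (v^T w x * v^T z y)) * (v^T z c * v^T w d)).
    rewrite exchange_big; apply: eq_bigr => w _; apply: eq_bigr => z _.
    rewrite !mxE; congr (_ * _).
    transitivity (\sum_x \sum_y v a x * v b y * salg (distinct C x y w z)).
      by apply: eq_bigr => x _; apply: eq_bigr => y _; rewrite distinct_swap.
    rewrite -h; apply: eq_bigr => x _; apply: eq_bigr => y _.
    by rewrite !mxE.
  rewrite (contract2 (fun x y => salg (distinct C a b x y))) ?trmxK //.
  by rewrite distinct_swap.
- transitivity (\sum_p \sum_q salg (distinct C a b p q) * (v q c * v p d)).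
    rewrite exchange_big; apply: eq_bigr => q _; apply: eq_bigr => p _.
    by rewrite distinct_swap.
  under eq_bigr do under eq_bigr do rewrite -h sum_perm4E.
  rewrite (contract2 (fun z w =>
    \sum_x \sum_y v a x * v b y * salg (distinct C x y z w))) //.
  by apply: eq_bigr => x _; apply: eq_bigr => y _; rewrite distinct_swap.
Qed.

Lemma SOm1_relP v : SOm1_rel v <->
  [/\ real_orthogonal v, commutes v (@pairing C) & commutes v (@distinct C)].
Proof.
split=> [hv|[hv /(commutes_pairing hv)[hr hc hC] /(commutes_distinct hv) hD]].
  have [ho hr hc hC _] := hv; split=> //; first exact/commutes_pairing.
  apply/commutes_distinct => // a b c d.
  by rewrite (D_ffun hv) injectiveb_mindex4 rmorph_nat.
split=> //; pose i k : 'I_4 := inord k.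
have := hD (i 0%N) (i 1%N) (i 2%N) (i 3%N).
have -> : distinct C (i 0%N) (i 1%N) (i 2%N) (i 3%N) = 1.
  by rewrite /distinct /= !inE -!val_eqE /= !inordK.
rewrite rmorph1; apply: etrans; apply: eq_bigr => s _; apply: eq_bigr => j _.
congr (v _ _); rewrite ffunE; case: j => -[|[|[|[|//]]]] k4 /=; apply: val_inj;
by rewrite /= inordK.
Qed.

End Determinant.

(** * The relations imposed by the category *)

Section EvenCategory.
Variables (C : numClosedFieldType) (N : nat).

Section TwoLegs.
Variables (A : starAlgType C) (u : 'M[A]_N).

Definition mindex2 (a b : 'I_N) : mindex N 2 := [ffun i : 'I_2 => nth a [:: a; b] i].

Lemma mindex2K (z : mindex N 2) : mindex2 (z ord0) (z ord_max) = z.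
Proof.
by apply/ffunP => -[[|[|//]] k2]; rewrite ffunE /=; congr (z _); apply: val_inj.
Qed.

Lemma sum_mindex2 (F : mindex N 2 -> A) : \sum_z F z = \sum_a \sum_b F (mindex2 a b).
Proof.
rewrite pair_bigA /= (reindex (fun p => mindex2 p.1 p.2)) //.
exists (fun z : mindex N 2 => (z ord0, z ord_max)) => [[a b] _|z _] /=.
  by rewrite !ffunE.
exact: mindex2K.
Qed.

Lemma sum_mindex0 (F : mindex N 0 -> A) y : \sum_z F z = F y.
Proof. by rewrite (bigD1 y) //= big1 ?addr0 // => z; rewrite (mindex0 z y) eqxx. Qed.

Lemma tpow_mindex2 a b c d : tpow u (mindex2 a b) (mindex2 c d) = u a c * u b d.
Proof. by rewrite /tpow !big_ord_recl big_ord0 !ffunE mulr1. Qed.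

Lemma tpow_mindex0 (y x : mindex N 0) : tpow u y x = 1.
Proof. by rewrite /tpow big_ord0. Qed.

Lemma gspider22 (phi : 'I_N -> 'I_N -> C) a b c d :
  gspider phi (mindex2 a b) (mindex2 c d) = quartic phi a b c d.
Proof.
by apply: eq_bigr => i _; rewrite !big_ord_recl !big_ord0 !ffunE !mulr1.
Qed.

Lemma intertwines_gspider22 (phi : 'I_N -> 'I_N -> C) :
  intertwines u (@gspider C N phi 2 2) <-> commutes u (quartic phi).
Proof.
have e a b c d : (\sum_z salg (gspider phi (mindex2 a b) z) * tpow u z (mindex2 c d) =
      \sum_x \sum_y salg (quartic phi a b x y) * (u x c * u y d)) /\
    (\sum_z tpow u (mindex2 a b) z * salg (gspider phi z (mindex2 c d)) =
      \sum_x \sum_y u a x * u b y * salg (quartic phi x y c d)).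
  rewrite !sum_mindex2; split; apply: eq_bigr => x _; apply: eq_bigr => y _;
  by rewrite tpow_mindex2 gspider22.
split=> [h a b c d|h y x].
  by have [<- <-] := e a b c d; exact: h.
rewrite -(mindex2K y) -(mindex2K x).
by have [-> ->] := e (y ord0) (y ord_max) (x ord0) (x ord_max); exact: h.
Qed.

Section Cap.
Variable phi : 'I_N -> 'I_N -> C.
Hypothesis phi_col : forall a b, \sum_i phi i a * phi i b = (a == b)%:R.

Lemma gspider20 y a b : @gspider C N phi 2 0 y (mindex2 a b) = (a == b)%:R.
Proof.
rewrite -phi_col; apply: eq_bigr => i _.
by rewrite !big_ord_recl !big_ord0 !ffunE mul1r !mulr1.
Qed.

Lemma gspider02 x a b : @gspider C N phi 0 2 (mindex2 a b) x = (a == b)%:R.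
Proof.
rewrite -phi_col; apply: eq_bigr => i _.
by rewrite !big_ord_recl !big_ord0 !ffunE !mulr1.
Qed.

Lemma intertwines_gspider20 : intertwines u (@gspider C N phi 2 0) <-> u^T *m u = 1%:M.
Proof.
have e y c d :
    (\sum_z salg (gspider phi y z) * tpow u z (mindex2 c d) = (u^T *m u) c d) /\
    (\sum_(z : mindex N 0) tpow u y z * salg (gspider phi z (mindex2 c d)) =
     (1%:M : 'M[A]_N) c d).
  split.
    rewrite sum_mindex2 !mxE; apply: eq_bigr => a _.
    under eq_bigr do rewrite gspider20 tpow_mindex2.
    by rewrite sum_delta mxE.
  by rewrite (sum_mindex0 _ y) tpow_mindex0 gspider20 mul1r mxE rmorph_nat.
split=> [h|h y x].
  apply/matrixP => c d; have [<- <-] := e [ffun=> c] c d; exact: h.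
rewrite -(mindex2K x); have [-> ->] := e y (x ord0) (x ord_max).
by rewrite h.
Qed.

Lemma intertwines_gspider02 : u *m u^T = 1%:M -> intertwines u (@gspider C N phi 0 2).
Proof.
move=> uut y x; rewrite -(mindex2K y) (sum_mindex0 _ x) tpow_mindex0 gspider02 mulr1.
rewrite sum_mindex2 rmorph_nat.
transitivity ((u *m u^T) (y ord0) (y ord_max)); first by rewrite uut mxE.
rewrite mxE; apply: eq_bigr => a _.
under eq_bigr do rewrite gspider02 tpow_mindex2 -salgC.
by rewrite sum_delta mxE.
Qed.

End Cap.
End TwoLegs.

Variable H : 'M[C]_N.
Hypothesis hH : hadamard H.

(** Carrying the adjoint along in the induction disposes of the dagger without
    inverting the tensor powers of u. *)
Lemma even_intertwines (A : starAlgType C) (u : 'M[A]_N) :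
  real_orthogonal u -> (forall s, commutes u (quartic (basis H s))) ->
  forall k l (f : ncmor C k l), NCBipartEven N%:R f ->
  intertwines u (FH H f) /\ intertwines u (ldag (FH H f)).
Proof.
move=> [_ uut utu] hs.
have gen22 s : intertwines u (FH H (Ngen C s 2 2)) /\
    intertwines u (ldag (FH H (Ngen C s 2 2))).
  rewrite FH_gen gspider_dag; last exact: basis_real.
  by split; apply/intertwines_gspider22.
move=> k l f; elim=> {k l f}.
- by move=> k l f g fg _; rewrite (FH_sound hH fg).
- exact: gen22.
- exact: gen22.
- rewrite FH_gen gspider_dag; last exact: basis_real.
  split; first by apply/intertwines_gspider20 => //; exact: basis_col.
  by apply: intertwines_gspider02 => //; exact: basis_col.
- move=> k /=; split; first exact: intertwines_id.
  rewrite (_ : ldag _ = @lid C N k); first exact: intertwines_id.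
  by apply: lin_ext => y x; rewrite /ldag /lid conjC_nat eq_sym.
- move=> k l /=; split; first exact: intertwines_zero.
  rewrite (_ : ldag _ = fun _ _ => 0); first exact: intertwines_zero.
  by apply: lin_ext => y x; rewrite /ldag conjC0.
- move=> k l f g _ [hf hf'] _ [hg hg'] /=; split; first exact: intertwines_add.
  rewrite (_ : ldag _ = fun y x => ldag (FH H f) y x + ldag (FH H g) y x).
    exact: intertwines_add.
  by apply: lin_ext => y x; rewrite /ldag rmorphD.
- move=> k l c f _ [hf hf'] /=; split; first exact: intertwines_scale.
  rewrite (_ : ldag _ = fun y x => c^* * ldag (FH H f) y x).
    exact: intertwines_scale.
  by apply: lin_ext => y x; rewrite /ldag rmorphM.
- move=> k l m g f _ [hg hg'] _ [hf hf'] /=; split; first exact: intertwines_comp.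
  rewrite (_ : ldag _ = lcomp (ldag (FH H f)) (ldag (FH H g))).
    exact: intertwines_comp.
  apply: lin_ext => y x; rewrite /ldag /lcomp rmorph_sum.
  by apply: eq_bigr => z _; rewrite rmorphM mulrC.
- move=> k1 l1 k2 l2 f g _ [hf hf'] _ [hg hg'] /=; split; first exact: intertwines_tens.
  rewrite (_ : ldag _ = ltens (ldag (FH H f)) (ldag (FH H g))).
    exact: intertwines_tens.
  by apply: lin_ext => y x; rewrite /ldag /ltens rmorphM.
- move=> k l f _ [hf hf'] /=; split=> //.
  rewrite (_ : ldag _ = FH H f) //.
  by apply: lin_ext => y x; rewrite /ldag conjCK.
Qed.

(** The cap alone gives u^T u = 1, and u u^dagger = 1 then forces
    u^T = u^dagger, so that the entries of u are self-adjoint. *)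
Lemma cat_relP (A : starAlgType C) (u : 'M[A]_N) :
  cat_rel (FH_image H (@NCBipartEven C N%:R)) u <->
  real_orthogonal u /\ (forall s, commutes u (quartic (basis H s))).
Proof.
split=> [[uu' u'u h]|[hu hs]].
  have utu : u^T *m u = 1%:M.
    apply/(@intertwines_gspider20 _ u (basis H Black)); first exact: basis_col.
    rewrite -FH_gen; apply: h; exists (Ngen C Black 2 0) => //.
    exact: even_b20.
  have uE : u^T = adjmx u by rewrite -[LHS]mulmx1 -uu' mulmxA utu mul1mx.
  split; first split=> //.
  - by move=> i j; have /matrixP/(_ j i) := uE; rewrite !mxE.
  - by rewrite uE.
  - move=> s; apply/intertwines_gspider22; rewrite -FH_gen; apply: h.
    exists (Ngen C s 2 2) => //; case: s; [exact: even_b22 | exact: even_w22].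
have [su uut utu] := hu.
have uE : adjmx u = u^T by apply/matrixP => i j; rewrite !mxE su.
split; rewrite ?uE // => k l T [f hf ->].
by have [] := even_intertwines hu hs hf.
Qed.

End EvenCategory.

(** * Comparison of the two sets of relations *)

Section Iso.
Variables (C : numClosedFieldType) (H : 'M[C]_4).
Hypothesis hH : hadamard H.

Definition white_mx : 'M[C]_4 := \matrix_(i, j) white H i j.

Lemma white_mx_orthogonal : orthogonal_mx white_mx.
Proof.
apply/matrixP => i j; rewrite !mxE -(white_row hH).
by apply: eq_bigr => a _; rewrite !mxE.
Qed.

Lemma white_mx_flat : flat white_mx.
Proof. by move=> i j; rewrite mxE white_sq. Qed.

Lemma mub_real : real_mx (mub white_mx).
Proof.
by move=> i j; rewrite mubE mxE; case: ifP => _; rewrite ?rmorphN /= white_real.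
Qed.

Lemma commutes_basis (A : starAlgType C) (u : 'M[A]_4) :
  (forall s, commutes u (quartic (basis H s))) <->
  commutes u (quartic (1%:M : 'M[C]_4)) /\ commutes u (quartic white_mx).
Proof.
have bE a b c d : quartic (basis H Black) a b c d = quartic (1%:M : 'M[C]_4) a b c d.
  by apply: eq_bigr => i _; rewrite !mxE /= /black ![_ == i]eq_sym.
have wE a b c d : quartic (basis H White) a b c d = quartic white_mx a b c d.
  by apply: eq_bigr => i _; rewrite !mxE.
split=> [h|[hb hw] [|]].
- by split; [exact: eq_commutes bE (h Black) | exact: eq_commutes wE (h White)].
- by apply: eq_commutes hb => a b c d; rewrite bE.
- by apply: eq_commutes hw => a b c d; rewrite wE.
Qed.

(** In hyperoctahedral form both sides are the same statement, since u in the
    basis phi is M u M^T in the basis phi M^T. *)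
Lemma commutes_base_change (A : starAlgType C) (phi M : 'M[C]_4) (u : 'M[A]_4) :
  orthogonal_mx phi -> orthogonal_mx M ->
  commutes u (quartic phi) <-> commutes (base_change M u) (quartic (phi *m M^T)).
Proof.
move=> ophi oM.
have e : base_change (phi *m M^T) (base_change M u) = base_change phi u.
  by rewrite base_changeM -mulmxA orthogonal_mxV // mulmx1.
rewrite commutes_quartic // commutes_quartic ?e //.
exact: orthogonal_mxM ophi (orthogonal_mx_tr oM).
Qed.

Lemma cat_rel_SOm1_rel (A : starAlgType C) (u : 'M[A]_4) :
  cat_rel (FH_image H (@NCBipartEven C 4%:R)) u <->
  SOm1_rel (base_change (mub white_mx) u).
Proof.
have oW := white_mx_orthogonal; have fW := white_mx_flat.
have oM := mub_orthogonal oW; have rM := mub_real.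
have o1 : orthogonal_mx (1%:M : 'M[C]_4) by rewrite /orthogonal_mx trmx1 mulmx1.
rewrite cat_relP // commutes_basis SOm1_relP.
rewrite (commutes_base_change u o1 oM) (commutes_base_change u oW oM) mul1mx.
rewrite (commutes_mub oW fW).
split=> [[hu [hp hd]]|[hv hp hd]].
  by split=> //; exact: real_orthogonal_base_change.
split=> //; have <- : base_change (mub white_mx)^T (base_change (mub white_mx) u) = u.
  by rewrite base_changeM orthogonal_mxV // base_change1.
apply: real_orthogonal_base_change => //; first exact: orthogonal_mx_tr.
by move=> i j; rewrite mxE rM.
Qed.

End Iso.

Local Open Scope complex_scope.

Theorem theorem5p7 (R : realType) (H : 'M[R[i]]_4) (hH : hadamard H) :
  qgroup_iso (cat_qgroup (FH_image H (@NCBipartEven R[i] 4%:R)))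
             (SOm1_4 R[i]).
Proof.
have oM := mub_orthogonal (white_mx_orthogonal hH).
apply: (presented_qgroup_iso _ _ _ _ oM) => A u; first by move/cat_rel_SOm1_rel; apply.
move=> hv; apply/(cat_rel_SOm1_rel hH).
by rewrite base_changeM oM base_change1.
Qed.
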